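(* Let $N=n+k$, $\lambda,\mu,\nu\in\mathfrak P_{\le k,n}$, $d\ge0$ and $j\in\{1,\dots,N\}$. If $\psi_j\mu=0$ (i.e. $w_j(\mu)=0$), then $$C_{\lambda\mu}^{\nu,d}(k,N)=\sum_{r=0}^{\ell(\lambda)}(-1)^{d+r+\mathrm n_{j-1}(\mu)+\mathrm n_{j-r-1}(\nu)}\sum_{\lambda/\rho=(1^r)}C_{\rho,\ \psi_j^*\mu}^{\psi_{j-r}^*\nu,\ d_r}(k+1,N).$$ Otherwise (i.e. if $w_j(\mu)=1$), $$C_{\lambda\mu}^{\nu,d}(k,N)=\sum_{r=0}^{\lambda_1}(-1)^{d+\mathrm n_{j-1}(\mu)+\mathrm n_{j+r-1}(\nu)}\sum_{\lambda/\rho=(r)}C_{\rho,\ \psi_j\mu}^{\psi_{j+r}\nu,\ d_r'}(k-1,N).$$ Here $$d_r=\begin{cases}d-1,&j<r,\\ d,&\text{else},\end{cases}\qquad d_r'=\begin{cases}d-1,&j+r>N,\\ d,&\text{else}.\end{cases}$$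
   Context: $\mathfrak P_{\le k,n}$: partitions with at most $k$ rows and $n$ columns, $N=n+k$. Each $\lambda\in\mathfrak P_{\le k,n}$ is identified with a 01-word $w(\lambda)=w_1\cdots w_N$ with exactly $k$ ones, located at positions $\ell_i=\lambda_{k+1-i}+i$, $1\le i\le k$. $\mathrm n_i(\lambda)=w_1+\dots+w_i$ for $0\le i\le N$, extended to all $i\in\mathbb Z$ by $\mathrm n_{i+N}=\mathrm n_i+k$ for words with $k$ ones. In the indices of the structure constants, $\psi_j^*\mu$ denotes (without sign) the partition in $\mathfrak P_{\le k+1,n-1}$ whose word is obtained from $w(\mu)$ by changing the $j$-th letter from 0 to 1, and $\psi_j\mu$ the partition in $\mathfrak P_{\le k-1,n+1}$ whose word is obtained by changing the $j$-th letter from 1 to 0; letter positions are taken modulo $N$. If the letter to be changed does not have the required value, the result is $0$ and the corresponding structure constant is understood to be $0$. Structure constants are also understood to be $0$ if $\rho$ does not fit into the relevant bounding box ($\mathfrak P_{\le k+1,n-1}$, resp. $\mathfrak P_{\le k-1,n+1}$) or if the degree is negative. $\lambda/\rho=(1^r)$ (resp. $(r)$) means that $\rho\subseteq\lambda$ and $\lambda/\rho$ is a vertical (resp. horizontal) strip with $r$ boxes; the inner sums run over such partitions $\rho$. $\ell(\lambda)$ is the number of nonzero parts. $C_{\lambda\mu}^{\nu,d}(k,N)$ are the 3-point genus 0 Gromov–Witten invariants of $\mathrm{Gr}_{k,N}$, i.e. the structure constants of $qH^\bullet(\mathrm{Gr}_{k,N})\cong\mathbb Z[q]\otimes\mathbb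 Z[e_1,\dots,e_k]/\langle h_{n+1},\dots,h_{N-1},h_N+(-1)^kq\rangle$ (symmetric polynomials in $k$ variables) in the $\mathbb Z[q]$-basis of Schur polynomials $s_\lambda$, $\lambda\in\mathfrak P_{\le k,n}$: $s_\lambda s_\mu=\sum_{\nu,d}C_{\lambda\mu}^{\nu,d}(k,N)q^ds_\nu$ (for $k=0$ the ring is $\mathbb Z[q]$ with basis $s_\emptyset=1$).
   Formalization: The degree is corrected to d_r = d−1 for j ≤ r (instead of j < r) and d otherwise; as printed the first formula fails at j = r, e.g. k = n = 1, λ = μ = (1), ν = ∅, d = 0, j = 1 gives −1 instead of 0. *)

(* Defs.v *)
From HB Require Import structures.
From mathcomp Require Import all_boot all_order all_algebra.
From mathcomp Require Import mpoly.
From Stdlib Require Import ClassicalEpsilon.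

Set Implicit Arguments.
Unset Strict Implicit.
Unset Printing Implicit Defensive.

Import Order.TTheory GRing.Theory Num.Theory.
Local Open Scope ring_scope.

(* Partitions with at most k rows and n columns, as weakly decreasing
   k-tuples padded with zeros. Throughout, N = n + k. *)
Record boxpart (k n : nat) := BoxPart {
  bptuple : k.-tuple 'I_n.+1;
  _ : sorted geq [seq val x | x <- bptuple] }.

HB.instance Definition _ (k n : nat) := [isSub for @bptuple k n].
HB.instance Definition _ (k n : nat) := [Countable of boxpart k n by <:].
HB.instance Definition _ (k n : nat) := [Finite of boxpart k n by <:].

(* Index from 0, in a word of length N, of the letter at position j, where
   positions are numbered from 1 and taken modulo N. *)
Definition letter_index (N : nat) (j : int) : nat := `|((j - 1) %% N%:Z)%Z|%N.

Section Partitions.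
Variables k n : nat.
Implicit Types la mu nu rho : boxpart k n.

(* Rows are numbered from 0: [part la i] is the (i+1)-st part of la. *)
Definition part la (i : nat) : nat := nth 0%N [seq val x | x <- bptuple la] i.

Definition nonzero_parts la : seq nat :=
  [seq p <- [seq val x | x <- bptuple la] | (0 < p)%N].

Definition plength la : nat := size (nonzero_parts la).

Definition psub rho la : bool := [forall i : 'I_k, part rho i <= part la i]%N.

Definition skew la rho : {set 'I_k * 'I_n} :=
  [set b : 'I_k * 'I_n | (part rho b.1 <= b.2 < part la b.1)%N].

(* la/rho = (1^r): no two of the r boxes in the same row. *)
Definition vstrip la rho (r : nat) : bool :=
  [&& psub rho la, #|skew la rho| == r
    & dinjectiveb (fun b : 'I_k * 'I_n => b.1) (mem (skew la rho))].

(* la/rho = (r): no two of the r boxes in the same column. *)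
Definition hstrip la rho (r : nat) : bool :=
  [&& psub rho la, #|skew la rho| == r
    & dinjectiveb (fun b : 'I_k * 'I_n => b.2) (mem (skew la rho))].

(* Letter p+1 of the word is 1 iff p+1 = la_(k+1-i) + i for some 1 <= i <= k;
   the bound variable below is i - 1. *)
Definition word la : seq bool :=
  mkseq (fun p => [exists i : 'I_k, p.+1 == part la (k - i.+1) + i.+1]%N)
        (n + k).

Definition letter la (j : int) : bool :=
  nth false (word la) (letter_index (n + k) j).

(* w_1 + ... + w_i, extended to all integers i by n_(i+N) = n_i + k. *)
Definition nones la (i : int) : int :=
  (count id (take `|(i %% (n + k)%N%:Z)%Z|%N (word la)))%:Z
  + k%:Z * (i %/ (n + k)%N%:Z)%Z.

End Partitions.

(* The same partition in another bounding box; None if it does not fit. *)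
Definition refit (k n k' n' : nat) (rho : boxpart k n) :
    option (boxpart k' n') :=
  [pick rho' : boxpart k' n' | nonzero_parts rho' == nonzero_parts rho].

(* The value None stands for 0. Changing a 0 requires n > 0 and changing a
   1 requires k > 0, so N is the same in the new box. *)
Definition psistar (k n : nat) (j : int) (la : boxpart k n) :
    option (boxpart k.+1 n.-1) :=
  if letter la j then None else
  [pick la' : boxpart k.+1 n.-1 |
     word la' == set_nth false (word la) (letter_index (n + k) j) true].

Definition psi (k n : nat) (j : int) (la : boxpart k n) :
    option (boxpart k.-1 n.+1) :=
  if letter la j then
    [pick la' : boxpart k.-1 n.+1 |
       word la' == set_nth false (word la) (letter_index (n + k) j) false]
  else None.

Section QuantumCohomology.
Variables k n : nat.

(* Z[q] (x) Z[e_1, .., e_k] is the ring of symmetric elements of this ring. *)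
Local Notation A := {mpoly {poly int}[k]}.

Definition hsym (r : nat) : A :=
  \sum_(m : 'X_{1..k < r.+1} | mdeg m == r) 'X_[m].

Definition hsymz (r : int) : A := if r is Posz r' then hsym r' else 0.

(* Jacobi-Trudi: det (h_(la_i - i + j)). *)
Definition schur (la : boxpart k n) : A :=
  \det (\matrix_(i < k, j < k) hsymz ((part la i)%:Z - i%:Z + j%:Z)).

Definition qvar : A := ('X : {poly int})%:MP.

(* h_(n+1), .., h_(N-1), h_N + (-1)^k q; for k = 0 the ring is Z[q] itself,
   so there are no relations. *)
Definition qrelations : seq A :=
  if k is 0 then [::]
  else rcons [seq hsym r | r <- iota n.+1 k.-1]
             (hsym (n + k) + (-1) ^+ k * qvar).

(* The ideal generated by the relations in the ring of symmetric polynomials,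
   hence the symmetric coefficients. *)
Definition in_qideal (p : A) : Prop :=
  exists2 a : nat -> A, (forall i, a i \is symmetric) &
    p = \sum_(i < size qrelations) a i * qrelations`_i.

Definition is_qexpansion (la mu : boxpart k n)
    (c : boxpart k n -> {poly int}) : Prop :=
  in_qideal (schur la * schur mu - \sum_nu c nu *: schur nu).

(* The Z[q]-coordinates of s_la s_mu in the Schur basis of the quotient. *)
Definition qexpansion (la mu : boxpart k n) : boxpart k n -> {poly int} :=
  epsilon (inhabits (fun=> 0)) (is_qexpansion la mu).

(* C_(la mu)^(nu, d)(k, N) with N = n + k. *)
Definition GW (la mu nu : boxpart k n) (d : nat) : int :=
  (qexpansion la mu nu)`_d.

(* 0 as soon as an index is undefined or the degree is negative. *)
Definition GW0 (la mu nu : option (boxpart k n)) (d : int) : int :=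
  match la, mu, nu, d with
  | Some la', Some mu', Some nu', Posz d' => GW la' mu' nu' d'
  | _, _, _, _ => 0
  end.

End QuantumCohomology.

(* The degree drops exactly when the position j - r leaves 1, .., N, that is
   when j <= r. With a strict inequality the recursion fails at j = r: for P^1
   (k = n = 1), la = mu = (1), nu = 0, d = 0, j = 1, it would give -1 instead
   of C = 0. *)
Definition vdegree (d j r : nat) : int :=
  if (j <= r)%N then d%:Z - 1 else d%:Z.

Definition hdegree (N d j r : nat) : int :=
  if (N < j + r)%N then d%:Z - 1 else d%:Z.

(* Main.v *)
Require Import Defs.
From HB Require Import structures.
From Stdlib Require Import ClassicalEpsilon.
From mathcomp Require Import all_boot all_order all_fingroup all_algebra.
From mathcomp Require Import ssrcomplements mpoly zify ring.

Set Implicit Arguments.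
Unset Strict Implicit.
Unset Printing Implicit Defensive.

Import Order.TTheory GRing.Theory Num.Theory.
Local Open Scope ring_scope.

(** Let N = n + k and c = (-1)^(k+1) q. Symmetric polynomials in x_1, .., x_k act
on the k-th exterior power of Z[q][x]/(x^N - c), the variable x_i multiplying
the i-th factor. For a partition la let v_la be the wedge of the x^p, where p
runs over the positions (counted from 0) of the ones in the word of la. The
bialternant formula [alternantE] says that s_la sends the wedge of 1, x, ..,
x^(k-1) to v_la. The relations of the quantum cohomology ring kill that wedge
[ideal_wcoord], and conversely the window h_(n+1), .., h_N of complete
symmetric polynomials is c times the window h_(1-k), .., h_0 modulo the
relations, so that every Jacobi-Trudi determinant reduces to a Schur polynomial
exactly as the corresponding wedge reduces to some v_nu [jt_reduce]. Hence
C_(la mu)^(nu, d) is the coefficient of q^d in the v_nu-coordinate of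
s_la v_mu [qexpansionE].

Changing a letter of a word from 0 to 1 or back is now, up to sign, wedging with
x^(j-1) or contracting against the coordinate of x^(j-1). Two expansions of
Schur polynomials move s_la through these operations. If letter j of mu is 1,
pull the factor x^(j-1) out of v_mu and use
s_la(x_1, .., x_k) = sum of x_p^r s_rho(all variables but x_p) over horizontal
strips [schur_horizontal_branching]; the factor becomes x^(j+r-1), which must
be one of the factors of v_nu. If letter j of mu is 0, write v_mu as the
contraction of the wedge v_(psi_j^* mu) of k + 1 factors and use the inverse
rule s_la(all variables but x_p) = sum of (-x_p)^r s_rho(x_1, .., x_(k+1)) over
vertical strips [schur_vertical_branching]; the contraction becomes the one at
position j - r. In both cases the new position is taken modulo N, and each turn
around the circle costs one factor c, which lowers the degree by one. The signs
are those of row and column expansions of determinants, that is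
n_(j-1)(mu) and n_(j-r-1)(nu) or n_(j+r-1)(nu), and the sign (-1)^d appears
because c changes sign when k does [GW_wcoord]. A partition rho that
does not fit the new box contributes zero, either because its Schur polynomial
vanishes [refit_down_none] or because the quantum relations kill it
[wcoord_refit_none]. *)

Local Notation "m # s" := [multinom m (s i) | i < _]
  (at level 40, left associativity, format "m # s").

(** * Linear functionals on polynomials *)

Section LinearExtension.
Variables (R : comNzRingType) (k : nat).
Implicit Types (F G : 'X_{1..k} -> R) (p q : {mpoly R[k]}).

Definition linext F p : R := \sum_(m <- msupp p) p@_m * F m.

Lemma linextE F p d : (msize p <= d)%N ->
  linext F p = \sum_(m : 'X_{1..k < d}) p@_m * F m.
Proof.
move=> le_pd; set I : subFinType _ := 'X_{1..k < d}.
rewrite /linext (big_mksub I) ?msupp_uniq //=; last first.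
  by move=> m /msize_mdeg_lt /leq_trans; apply.
by rewrite big_rmcond //= => m /memN_msupp_eq0 ->; rewrite mul0r.
Qed.

Lemma linext_is_linear F : scalable_for *%R (linext F) * additive (linext F).
Proof.
split=> [a p|p q].
  pose d := maxn (msize p) (msize (a *: p)).
  rewrite !(@linextE _ _ d) ?leq_max ?leqnn ?orbT // mulr_sumr.
  by apply: eq_bigr => m _; rewrite mcoeffZ mulrA.
pose d := maxn (msize (p - q)) (maxn (msize p) (msize q)).
rewrite !(@linextE _ _ d) ?leq_max ?leqnn ?orbT // -sumrB.
by apply: eq_bigr => m _; rewrite mcoeffB mulrBl.
Qed.

HB.instance Definition _ F := GRing.isZmodMorphism.Build {mpoly R[k]} R (linext F)
  (linext_is_linear F).2.
HB.instance Definition _ F := GRing.isScalable.Build R {mpoly R[k]} R *%R (linext F)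
  (linext_is_linear F).1.

Lemma linextX F m : linext F 'X_[m] = F m.
Proof. by rewrite /linext msuppX big_seq1 mcoeffX eqxx mul1r. Qed.

Lemma eq_linext F G p : F =1 G -> linext F p = linext G p.
Proof. by move=> eqFG; apply: eq_bigr => m _; rewrite eqFG. Qed.

Lemma linext_scale a F p : linext (fun m => a * F m) p = a * linext F p.
Proof. by rewrite mulr_sumr; apply: eq_bigr => m _; rewrite mulrCA. Qed.

Lemma linext_sum I (r : seq I) (F : I -> 'X_{1..k} -> R) p :
  linext (fun m => \sum_(i <- r) F i m) p = \sum_(i <- r) linext (F i) p.
Proof.
by rewrite exchange_big; apply: eq_bigr => m _; rewrite mulr_sumr.
Qed.

Lemma linextMX F m p : linext F (p * 'X_[m]) = linext (fun m' => F (m' + m)%MM) p.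
Proof.
rewrite {1}[p]mpolyE mulr_suml linear_sum; apply: eq_bigr => m' _ /=.
by rewrite -scalerAl linearZ /= -mpolyXD linextX.
Qed.

Lemma linext_msym F (s : 'S_k) p :
  linext F (msym s p) = linext (fun m => F (m # (s^-1)%g)) p.
Proof.
rewrite {1}[p]mpolyE (raddf_sum (msym s)) linear_sum; apply: eq_bigr => m _ /=.
by rewrite msymZ linearZ /= msymX linextX.
Qed.

End LinearExtension.

Section Inclusion.
Variables (R : comNzRingType) (k : nat) (p : 'I_k.+1).

(** Substitution of the variables other than x_p, in order, into a polynomial. *)
Definition skipvar : {mpoly R[k]} -> {mpoly R[k.+1]} :=
  mmap (@mpolyC k.+1 R) (fun i => 'X_(lift p i)).

HB.instance Definition _ := GRing.RMorphism.on skipvar.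

Definition insert_mnm (a : nat) (m : 'X_{1..k}) : 'X_{1..k.+1} :=
  [multinom oapp m a (unlift p i) | i < k.+1].

Lemma insert_mnm_lift a m i : insert_mnm a m (lift p i) = m i.
Proof. by rewrite mnmE liftK. Qed.

Lemma insert_mnm_at a m : insert_mnm a m p = a.
Proof. by rewrite mnmE unlift_none. Qed.

Lemma mnm_lift_eqP (m1 m2 : 'X_{1..k.+1}) :
  m1 p = m2 p -> (forall i, m1 (lift p i) = m2 (lift p i)) -> m1 = m2.
Proof.
by move=> e0 e1; apply/mnmP=> i; case: (unliftP p i) => [j|] ->.
Qed.

Lemma skipvarZ a g : skipvar (a *: g) = a *: skipvar g.
Proof. by rewrite /skipvar mmapZ mul_mpolyC. Qed.

Lemma skipvarXM a m : 'X_p ^+ a * skipvar 'X_[m] = 'X_[insert_mnm a m].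
Proof.
rewrite /skipvar mmapX /mmap1 [RHS]mpolyXE_id (bigD1_ord p) //= insert_mnm_at.
by congr (_ * _); apply: eq_bigr => i _; rewrite insert_mnm_lift.
Qed.

Lemma linext_skipvar F a g :
  linext F ('X_p ^+ a * skipvar g) = linext (fun m => F (insert_mnm a m)) g.
Proof.
rewrite {1}[g]mpolyE rmorph_sum mulr_sumr linear_sum.
apply: eq_bigr => m _ /=.
by rewrite skipvarZ -scalerAr linearZ /= skipvarXM linextX.
Qed.

End Inclusion.

(** * Coordinates on the exterior power *)

Definition expo k (e : 'I_k -> nat) : 'X_{1..k} := [multinom e i | i < k].

Definition insert k (T : Type) (p : 'I_k.+1) (b : T) (e : 'I_k -> T) : 'I_k.+1 -> T :=
  fun j => oapp e b (unlift p j).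

Lemma insert_at k T p b (e : 'I_k -> T) : insert p b e p = b.
Proof. by rewrite /insert unlift_none. Qed.

Lemma insert_lift k T p b (e : 'I_k -> T) i : insert p b e (lift p i) = e i.
Proof. by rewrite /insert liftK. Qed.

Lemma eq_expo k (e e' : 'I_k -> nat) : e =1 e' -> expo e = expo e'.
Proof. by move=> eq_e; apply/mnmP=> i; rewrite !mnmE. Qed.

Section WedgeCoordinate.
Variables (R : comNzRingType) (N : nat) (c : R).

(** Coordinate along x^b of x^a in the free module with basis 1, .., x^(N-1) and
    x^N = c. *)
Definition coord (b a : nat) : R := (a %% N == b)%N%:R * c ^+ (a %/ N)%N.

(** Coordinate, along the wedge of the x^(e j), of the wedge of the x^(m i) in the
    exterior power of that module. *)
Definition wcoordm k (e : 'I_k -> nat) (m : 'X_{1..k}) : R :=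
  \det (\matrix_(i, j) coord (e j) (m i)).

(** Linearity in the monomial turns this into a functional on all polynomials. For
    symmetric f, the value at f x^a is the coordinate of the image under f of the
    wedge with exponents a; keeping x^a as a monomial instead of an alternating
    sum avoids dividing by k!. *)
Definition wcoord k (e : 'I_k -> nat) : {mpoly R[k]} -> R := linext (wcoordm e).

HB.instance Definition _ k e := GRing.Linear.on (@wcoord k e).

Lemma wcoordmP k (e : 'I_k -> nat) (m : 'X_{1..k}) (s : 'S_k) :
  wcoordm e (m # s) = (-1) ^+ s * wcoordm e m.
Proof.
rewrite /wcoordm -det_perm -det_mulmx -row_permE; congr (\det _).
by apply/matrixP=> i j; rewrite !mxE mnmE.
Qed.

Lemma eq_wcoord k (e e' : 'I_k -> nat) f : e =1 e' -> wcoord e f = wcoord e' f.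
Proof.
move=> eq_e; apply: eq_linext => m; congr (\det _).
by apply/matrixP=> i j; rewrite !mxE eq_e.
Qed.

Lemma wcoord_msym k (e : 'I_k -> nat) (s : 'S_k) f :
  wcoord e (msym s f) = (-1) ^+ s * wcoord e f.
Proof.
rewrite /wcoord linext_msym -linext_scale; apply: eq_linext => m.
by rewrite wcoordmP odd_permV.
Qed.

Hypothesis N_gt0 : (0 < N)%N.

Lemma coordDN b a : coord b (a + N) = c * coord b a.
Proof. by rewrite /coord modnDr divnDr // divnn N_gt0 addn1 exprS mulrCA. Qed.

Lemma coord_small b a : (a < N)%N -> coord b a = (a == b)%:R.
Proof. by move=> aN; rewrite /coord modn_small // divn_small // expr0 mulr1. Qed.

Lemma wcoord_quasi k (e : 'I_k -> nat) (p : 'I_k) f :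
  wcoord e (f * 'X_p ^+ N) = c * wcoord e f.
Proof.
rewrite /wcoord mpolyXn linextMX -linext_scale; apply: eq_linext => m.
rewrite -[RHS]addr0 -(mul0r (wcoordm e m)).
apply: (@determinant_multilinear _ _ _ _ _ p).
- apply/rowP=> j; rewrite !mxE mul0r addr0.
  by rewrite mnmDE mulmnE mnm1E eqxx mul1n coordDN.
- apply/matrixP=> i j; rewrite !mxE.
  by rewrite mnmDE mulmnE mnm1E (negPf (neq_lift _ _)) mul0n addn0.
- apply/matrixP=> i j; rewrite !mxE.
  by rewrite mnmDE mulmnE mnm1E (negPf (neq_lift _ _)) mul0n addn0.
Qed.

(** Pulling out the factor number p is the expansion of the determinant along
    row p. *)
Lemma wcoord_row k (e : 'I_k.+1 -> nat) (p : 'I_k.+1) a f :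
  wcoord e ('X_p ^+ a * skipvar p f) =
  \sum_(i < k.+1) (-1) ^+ (p + i) * coord (e i) a * wcoord (e \o lift i) f.
Proof.
rewrite /wcoord linext_skipvar.
under eq_linext => m.
  rewrite /wcoordm (expand_det_row _ p).
  under eq_bigr => i _ do rewrite mxE insert_mnm_at /cofactor mulrCA mulrA.
  over.
rewrite /= linext_sum; apply: eq_bigr => i _; rewrite linext_scale; congr (_ * _).
apply: eq_linext => m; congr (\det _).
by apply/matrixP=> r j; rewrite !mxE insert_mnm_lift.
Qed.

(** The coordinate along x^b in the factor number p, together with the wedge
    coordinate in the other factors: one term of a column expansion. *)
Definition mixed k (p : 'I_k.+1) (b : nat) (e : 'I_k -> nat) : {mpoly R[k.+1]} -> R :=
  linext (fun m => coord b (m p) * wcoordm e [multinom m (lift p i) | i < k]).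

HB.instance Definition _ k p b e := GRing.Linear.on (@mixed k p b e).

Lemma mixed_skipvar k (p : 'I_k.+1) b (e : 'I_k -> nat) a f :
  mixed p b e ('X_p ^+ a * skipvar p f) = coord b a * wcoord e f.
Proof.
rewrite /mixed linext_skipvar -linext_scale; apply: eq_linext => m.
rewrite insert_mnm_at; congr (_ * wcoordm e _).
by apply/mnmP=> i; rewrite mnmE insert_mnm_lift.
Qed.

(** Multiplying the factor number p by x^r moves the coordinate form from b to b',
    at the cost of a scalar that accounts for x^N = c. *)
Lemma mixedMX k (p : 'I_k.+1) b b' (e : 'I_k -> nat) r f x :
  (forall a, coord b (a + r) = x * coord b' a) ->
  mixed p b e (f * 'X_p ^+ r) = x * mixed p b' e f.
Proof.
move=> bb'; rewrite /mixed mpolyXn linextMX -linext_scale.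
apply: eq_linext => m; rewrite mulrA -bb'; congr (_ * wcoordm e _).
  by rewrite mnmDE mulmnE mnm1E eqxx mul1n.
apply/mnmP=> i; rewrite [LHS]mnmE [RHS]mnmE mnmDE mulmnE mnm1E.
by rewrite (negPf (neq_lift _ _)) mul0n addn0.
Qed.

Lemma mixed_signX k (p : 'I_k.+1) b b' (e : 'I_k -> nat) r f x :
    (forall a, coord b (a + r) = x * coord b' a) ->
  mixed p b e ((- 'X_p) ^+ r * f) = (-1) ^+ r * (x * mixed p b' e f).
Proof.
move=> bb'; have -> : (- 'X_p) ^+ r * f = (-1) ^+ r *: (f * 'X_p ^+ r).
  rewrite [(- 'X_p) ^+ r]exprNn -(rmorph_sign (@mpolyC k.+1 R)) -mulrA.
  by rewrite mul_mpolyC ['X_p ^+ r * f]mulrC.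
by rewrite linearZ /= (mixedMX _ _ _ bb').
Qed.

(** Wedge coordinate along x^b followed by the x^(e i), expanded along the column
    of b. *)
Definition contraction k (b : nat) (e : 'I_k -> nat) (f : {mpoly R[k.+1]}) : R :=
  \sum_(p < k.+1) (-1) ^+ p * mixed p b e f.

Lemma wcoord_col k (e : 'I_k.+1 -> nat) (i : 'I_k.+1) f :
  wcoord e f = (-1) ^+ i * contraction (e i) (e \o lift i) f.
Proof.
have signE (x y : R) a b : x * ((-1) ^+ (a + b) * y) = (-1) ^+ b * ((-1) ^+ a * (x * y)).
  by rewrite exprD; ring.
rewrite /contraction /wcoord.
under eq_linext => m.
  rewrite /wcoordm (expand_det_col _ i).
  under eq_bigr => p _ do rewrite mxE /cofactor signE.
  over.
rewrite /= linext_sum big_distrr; apply: eq_bigr => p _ /=.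
rewrite !linext_scale; congr (_ * (_ * _)).
apply: eq_linext => m; congr (_ * (\det _)).
by apply/matrixP=> r j; rewrite !mxE mnmE.
Qed.

Lemma eq_contraction k (e e' : 'I_k -> nat) b f : e =1 e' ->
  contraction b e f = contraction b e' f.
Proof.
move=> eq_e; apply: eq_bigr => p _; congr (_ * _); apply: eq_linext => m.
by congr (_ * (\det _)); apply/matrixP=> r j; rewrite !mxE eq_e.
Qed.

(** Two columns of the determinant agree. *)
Lemma contraction_mem k (e : 'I_k -> nat) b f :
  (exists i, e i = b) -> contraction b e f = 0.
Proof.
case=> i ei; have := wcoord_col (insert ord0 b e) ord0 f.
rewrite expr0 mul1r insert_at (eq_contraction _ (e' := e)) => [<-|j]; last first.
  by rewrite /= insert_lift.
apply: big1 => m _; rewrite /wcoordm -det_tr.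
rewrite (determinant_alternate (i1 := ord0) (i2 := lift ord0 i)) ?mulr0 //.
by move=> j; rewrite !mxE insert_lift insert_at ei.
Qed.

End WedgeCoordinate.

(** * Alternants *)

Section Antisymmetrization.
Variables (R : comNzRingType) (k : nat).
Implicit Types (f g : {mpoly R[k]}) (a : 'I_k -> nat).

Definition asym f : {mpoly R[k]} := \sum_(s : 'S_k) (-1) ^+ s * msym s f.

Definition alternant a : {mpoly R[k]} := \det (\matrix_(r, p) 'X_p ^+ a r).

Lemma asymX a : asym 'X_[expo a] = alternant a.
Proof.
rewrite /asym /alternant /determinant; apply: eq_bigr => s _; congr (_ * _).
rewrite msymX mpolyXE_id (reindex_inj (perm_inj (s := s))) /=.
by apply: eq_bigr => i _; rewrite !mxE !mnmE permK.
Qed.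

Lemma asymMl f g : f \is symmetric -> asym (f * g) = f * asym g.
Proof.
move=> /issymP symf; rewrite /asym mulr_sumr; apply: eq_bigr => s _.
by rewrite msymM symf mulrCA.
Qed.

(** The wedge coordinate is itself alternating, so all k! terms contribute the
    same. *)
Lemma wcoord_asym N c (e : 'I_k -> nat) f :
  wcoord N c e (asym f) = wcoord N c e f *+ k`!.
Proof.
rewrite /asym linear_sum /= -card_Sn -sumr_const; apply: eq_bigr => s _.
rewrite -(rmorph_sign (@mpolyC k R)) mul_mpolyC linearZ /= wcoord_msym.
by rewrite mulrA -signr_addb addbb mul1r.
Qed.

Lemma wcoord_sym_alternant N c (e a : 'I_k -> nat) f : f \is symmetric ->
  wcoord N c e (f * alternant a) = wcoord N c e (f * 'X_[expo a]) *+ k`!.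
Proof. by move=> symf; rewrite -asymX -asymMl // wcoord_asym. Qed.

(** A symmetric f can be replaced by its monomials one at a time under
    antisymmetrization; this is what later writes f as a combination of
    Jacobi-Trudi determinants. *)
Lemma asymMX f m0 :
  asym (f * 'X_[m0]) = \sum_(m <- msupp f) f@_m *: asym 'X_[m + m0].
Proof.
have fE s : msym s (f * 'X_[m0]) =
    \sum_(m <- msupp f) f@_m *: msym s 'X_[m + m0].
  rewrite {1}[f]mpolyE mulr_suml (raddf_sum (msym s)).
  by apply: eq_bigr => m _; rewrite -scalerAl -mpolyXD; apply: msymZ.
rewrite /asym; under eq_bigr => s _ do rewrite fE mulr_sumr.
rewrite exchange_big; apply: eq_bigr => m _; rewrite scaler_sumr.
by apply: eq_bigr => s _; rewrite scalerAr.
Qed.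

End Antisymmetrization.

(** * Complete symmetric polynomials and Jacobi-Trudi determinants *)

Local Notation R := {poly int}.

Lemma mcoeff_hsym k r m : (hsym k r)@_m = (mdeg m == r)%:R.
Proof.
rewrite /hsym big_mkcond /=.
have -> : \sum_(i : 'X_{1..k < r.+1})
    (if mdeg i == r then 'X_[i] else 0 : {mpoly R[k]}) =
  \sum_(i : 'X_{1..k < r.+1}) ((mdeg i == r)%:R : R) *: 'X_[i].
  by apply: eq_bigr => i _; case: eqP; rewrite ?scale1r ?scale0r.
case: (ltnP (mdeg m) r.+1) => [lt_mr|lt_rm].
  by rewrite (mcoeff_mpoly (fun i => (mdeg i == r)%:R)).
rewrite (raddf_sum (mcoeff m)) big1 => [|i _]; first by rewrite gtn_eqF.
rewrite /= mcoeffZ mcoeffX.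
case: (val i =P m) => [eq_im|]; rewrite ?mulr0 // mulr1.
by have := bmdeg i; rewrite eq_im ltnNge lt_rm.
Qed.

Lemma hsym_sym k r : hsym k r \is symmetric.
Proof.
apply/issymP=> s; apply/mpolyP=> m.
by rewrite mcoeff_sym !mcoeff_hsym mdeg_mperm.
Qed.

Lemma hsymz_sym k z : hsymz k z \is symmetric.
Proof. by case: z => r; rewrite ?hsym_sym // rpred0. Qed.

Lemma hsym0 k : hsym k 0 = 1.
Proof. by apply/mpolyP=> m; rewrite mcoeff_hsym mcoeff1 mdeg_eq0. Qed.

Lemma hsymz_neg k z : z < 0 -> hsymz k z = 0.
Proof. by case: z. Qed.

Lemma hsymz_novar z : hsymz 0 z = (z == 0)%:R.
Proof.
case: z => r //; apply/mpolyP=> m; rewrite mcoeff_hsym.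
have -> : m = 0%MM by apply/mnmP; case.
by rewrite mdeg0 -mpolyC_nat mcoeffC eqxx mulr1 eq_sym.
Qed.

Lemma mcoeff_skipvar k (p : 'I_k.+1) (g : {mpoly R[k]}) m :
  (skipvar p g)@_m = (m p == 0)%N%:R * g@_[multinom m (lift p i) | i < k].
Proof.
rewrite {1}[g]mpolyE rmorph_sum (raddf_sum (mcoeff m)) /=.
have skX m' : skipvar p 'X_[R, m'] = 'X_[insert_mnm p 0 m'].
  by rewrite -skipvarXM expr0 mul1r.
under eq_bigr => m' _ do rewrite skipvarZ skX mcoeffZ mcoeffX.
case: eqP => [mp0|mp0]; last first.
  rewrite mul0r big1 // => m' _; case: eqP; rewrite ?mulr0 //.
  by move=> mE; case: mp0; rewrite -mE insert_mnm_at.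
rewrite mul1r; set m1 := [multinom _ | i < k].
have mE : insert_mnm p 0 m1 = m.
  by apply: (mnm_lift_eqP (p := p)) => [|i]; rewrite ?insert_mnm_at ?insert_mnm_lift ?mnmE.
rewrite [in RHS](mpolyE g) (raddf_sum (mcoeff m1)); apply: eq_bigr => m' _ /=.
rewrite mcoeffZ mcoeffX; congr (_ * (nat_of_bool _)%:R).
apply/eqP/eqP => [eqm|->//]; apply/mnmP=> i.
by rewrite -(insert_mnm_lift p 0 m') eqm -mE insert_mnm_lift.
Qed.

Lemma mcoeffXM k (p : 'I_k) (f : {mpoly R[k]}) m :
  ('X_p * f)@_m = (0 < m p)%N%:R * f@_(m - U_(p))%MM.
Proof.
rewrite mulrC; case: ltnP => mp.
  have mK : (m - U_(p) + U_(p))%MM = m.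
    rewrite submK //; apply/mnm_lepP => i; rewrite mnm1E.
    by case: eqP => // <-.
  by rewrite -{1}mK addmC mcoeffMX mul1r.
rewrite mul0r {1}[f]mpolyE mulr_suml (raddf_sum (mcoeff m)) big1 // => m' _ /=.
rewrite -scalerAl -mpolyXD mcoeffZ mcoeffX; case: eqP; rewrite ?mulr0 // => mE.
by move: mp; rewrite -mE mnmDE mnm1E eqxx addn1.
Qed.

(** The coefficient of a monomial comes from the first term when x_p is absent
    and from the second one when x_p occurs. *)
Lemma hsymz_skip k (p : 'I_k.+1) z :
  hsymz k.+1 z = skipvar p (hsymz k z) + 'X_p * hsymz k.+1 (z - 1).
Proof.
case: z => [r|r]; last first.
  by rewrite 2?[hsymz k.+1 _]hsymz_neg ?[hsymz k _]hsymz_neg ?rmorph0 ?mulr0 ?addr0 //; lia.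
apply/mpolyP=> m; rewrite mcoeffD mcoeff_skipvar mcoeffXM /= !mcoeff_hsym.
have mdegm : mdeg m = (m p + mdeg [multinom m (lift p i) | i < k])%N.
  rewrite !mdegE (bigD1_ord p) //; congr (_ + _)%N.
  by apply: eq_bigr => i _; rewrite mnmE.
case: posnP => [mp0|mp]; first by rewrite mul1r mul0r addr0 mdegm mp0.
rewrite mul0r mul1r add0r.
have mE : mdeg m = (mdeg (m - U_(p))).+1.
  have mK : m = (m - U_(p) + U_(p))%MM.
    rewrite submK //; apply/mnm_lepP => i; rewrite mnm1E.
    by case: eqP => // <-.
  by rewrite {1}mK mdegD mdeg1 addn1.
case: r => [|r].
  by rewrite mE (@hsymz_neg _ (0%:Z - 1)) ?mcoeff0.
by rewrite -[r.+1]addn1 PoszD addrK /= mcoeff_hsym mE addn1 eqSS.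
Qed.

(** Adding the variable x_p multiplies the generating series of the c_i by
    1 - x_p t and, by [hsymz_skip], divides that of the complete symmetric
    polynomials by the same factor. *)
Lemma vieta_seq k : exists c : nat -> {mpoly R[k]},
  forall z : int, \sum_(i < k.+1) c i * hsymz k (z - i%:Z) = (z == 0)%:R.
Proof.
suff [c [cE _]] : exists c : nat -> {mpoly R[k]},
    (forall z : int, \sum_(i < k.+1) c i * hsymz k (z - i%:Z) = (z == 0)%:R) /\
    (forall i, (k < i)%N -> c i = 0) by exists c.
elim: k => [|k [c [cE c0]]].
  exists (fun i => (i == 0)%N%:R); split=> [z|[]//].
  by rewrite big_ord_recl big_ord0 addr0 mul1r subr0 hsymz_novar.
pose p : 'I_k.+1 := ord0.
exists (fun i => skipvar p (c i) - 'X_p * (if i is i'.+1 then skipvar p (c i') else 0)).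
split=> [z|[//|i] lt_ki]; last by rewrite !c0 ?(ltnW lt_ki) // rmorph0 mulr0 subr0.
under eq_bigr => i _ do rewrite mulrBl.
rewrite sumrB big_ord_recr /= c0 // rmorph0 mul0r addr0.
rewrite [X in _ - X]big_ord_recl /= mulr0 mul0r add0r -sumrB.
rewrite -(rmorph_nat (skipvar p)) -cE rmorph_sum; apply: eq_bigr => i _.
have -> : z - (bump 0 i)%:Z = z - i%:Z - 1 by rewrite /bump /=; lia.
rewrite rmorphM /= (hsymz_skip p).
by rewrite add0n mulrDr [skipvar p _ * ('X_p * _)]mulrCA -mulrA addrK.
Qed.

(** Up to signs the c_i are the elementary symmetric polynomials. They are
    symmetric because the recursion determines them from the h_r, which are. *)
Lemma vieta k : exists c : nat -> {mpoly R[k]},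
  [/\ c 0%N = 1, forall i : 'I_k.+1, c i \is symmetric &
   forall z : int, \sum_(i < k.+1) c i * hsymz k (z - i%:Z) = (z == 0)%:R].
Proof.
have [c cE] := vieta_seq k; exists c; split=> //.
  have := cE 0; rewrite big_ord_recl big1 => [|i _].
    by rewrite subr0 -[hsymz k 0]/(hsym k 0) hsym0 mulr1 addr0 eqxx.
  by rewrite hsymz_neg ?mulr0 // lift0; lia.
move=> i; apply/issymP=> s; case: i; elim/ltn_ind=> j IHj lt_jk /=.
have := congr1 (msym s) (cE j%:Z); rewrite rmorph_nat -cE (raddf_sum (msym s)).
rewrite (bigD1 (Ordinal lt_jk)) // [RHS](bigD1 (Ordinal lt_jk)) //=.
rewrite subrr /= hsym0 msymM msym1 !mulr1 => /eqP.
(* the equation in degree j determines c j from the earlier coefficients *)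
set S1 := (X in _ + X == _); set S2 := (X in _ == _ + X).
suff -> : S1 = S2 by move/eqP/addIr.
apply: eq_bigr => i neq_ij; rewrite msymM (issymP _ (hsymz_sym _ _)).
case: (ltngtP i j) => [lt_ij|lt_ji|eq_ij].
- by rewrite IHj ?ltn_ord.
- by rewrite hsymz_neg ?mulr0 //; lia.
- by case/eqP: neq_ij; apply: val_inj.
Qed.

(** The series of the c_i in all variables but x_p, times that of the h_r in all
    variables, is the geometric series of x_p. *)
Lemma vieta_skip k (c : nat -> {mpoly R[k]}) (p : 'I_k.+1) (a : nat) :
    (forall z : int, \sum_(i < k.+1) c i * hsymz k (z - i%:Z) = (z == 0)%:R) ->
  \sum_(i < k.+1) skipvar p (c i) * hsymz k.+1 (a%:Z - i%:Z) = 'X_p ^+ a.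
Proof.
move=> cE; pose F (z : int) := \sum_(i < k.+1) skipvar p (c i) * hsymz k.+1 (z - i%:Z).
rewrite -/(F _).
have FS z : F z = (z == 0)%:R + 'X_p * F (z - 1).
  rewrite -(rmorph_nat (skipvar p)) -cE rmorph_sum /F mulr_sumr -big_split.
  apply: eq_bigr => i _ /=; rewrite rmorphM /= (hsymz_skip p) mulrDr.
  by rewrite [in RHS]mulrCA; congr (_ + _ * ('X_p * hsymz _ _)); lia.
elim: a => [|a IHa].
  rewrite FS [F _]big1 ?mulr0 ?addr0 // => i _.
  by rewrite hsymz_neg ?mulr0 //; lia.
have aS : a.+1%:Z - 1 = a%:Z by lia.
by rewrite FS aS IHa add0r exprS.
Qed.

(** Jacobi-Trudi determinant with l rows in k variables, indexed by the increasing
    exponents a_i = la_(l-i) + i; rows may exceed variables, and the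
    integers a_i may be negative. *)
Definition jt k l (a : 'I_l -> int) : {mpoly R[k]} :=
  \det (\matrix_(i, j) hsymz k (a i - j%:Z)).

Lemma jt_sym k l (a : 'I_l -> int) : jt k a \is symmetric.
Proof.
rewrite rpred_sum // => s _; rewrite rpredMsign rpred_prod // => i _.
by rewrite mxE hsymz_sym.
Qed.

Lemma jt_id k l : jt k (fun i : 'I_l => i%:Z) = 1.
Proof.
rewrite /jt det_trig; last first.
  by apply/is_trig_mxP => i j lt_ij; rewrite mxE hsymz_neg //; lia.
by rewrite big1 // => i _; rewrite mxE subrr [LHS]hsym0.
Qed.

(** Bialternant formula: by [vieta_skip], the matrix of the x_p^(a r) is the
    matrix of the h_(a r - i) times a matrix D independent of a, and for the
    exponents 0, .., k-1 the first factor is unitriangular. *)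
Lemma alternantE k (a : 'I_k -> nat) :
  alternant R a = jt k (fun i => (a i)%:Z) * alternant R (@nat_of_ord k).
Proof.
case: k a => [|k] a.
  by rewrite /alternant /jt !det_mx00 mulr1.
have [c [_ _ cE]] := vieta k.
pose D := \matrix_(i < k.+1, p < k.+1) skipvar p (c i).
have altD (b : 'I_k.+1 -> nat) : alternant R b = jt k.+1 (fun i => (b i)%:Z) * \det D.
  rewrite /alternant /jt -det_mulmx; congr (\det _).
  apply/matrixP=> r p; rewrite !mxE -(vieta_skip _ _ cE).
  by apply: eq_bigr => i _; rewrite !mxE mulrC.
by rewrite altD [in RHS]altD jt_id mul1r.
Qed.

Lemma fact_poly_neq0 k : (k`!%:R : R) != 0.
Proof. by rewrite -(rmorph_nat (@polyC int)) polyC_eq0 pnatr_eq0 -lt0n fact_gt0. Qed.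

Lemma wcoordm_diag N (c : R) k (e : 'I_k -> nat) :
  injective e -> (forall i, e i < N)%N -> wcoordm N c e (expo e) = 1.
Proof.
move=> inj_e lt_eN; rewrite -[RHS](det1 R k); congr (\det _).
by apply/matrixP=> i j; rewrite !mxE mnmE coord_small // (inj_eq inj_e).
Qed.

Lemma vandermonde_neq0 k : alternant R (@nat_of_ord k) != 0.
Proof.
have sym1 : (1 : {mpoly R[k]}) \is symmetric by apply: rpred1.
apply: contraNneq (fact_poly_neq0 k) => alt0.
have := wcoord_sym_alternant k 0 (@nat_of_ord k) (@nat_of_ord k) sym1.
rewrite alt0 mulr0 linear0 mul1r /wcoord linextX wcoordm_diag //; last exact: val_inj.
by move=> <-.
Qed.

(** Multiply by the Vandermonde determinant, antisymmetrize monomial by monomial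
    and divide again. *)
Lemma sym_jtE k (f : {mpoly R[k]}) : f \is symmetric ->
  f = \sum_(m <- msupp f) f@_m *: jt k (fun i => (m i + i)%N%:Z).
Proof.
move=> symf; apply: (mulIf (vandermonde_neq0 k)).
rewrite -asymX -asymMl // asymMX mulr_suml; apply: eq_bigr => m _.
rewrite -scalerAl asymX -alternantE -asymX; congr (_ *: asym 'X_[_]).
by apply/mnmP=> i; rewrite mnmDE !mnmE.
Qed.

(** A Jacobi-Trudi determinant moves the wedge of 1, .., x^(k-1) to the wedge with
    exponents b; both sides agree after multiplication by k!. *)
Lemma wcoord_jt N (c : R) k (e b : 'I_k -> nat) f : f \is symmetric ->
  wcoord N c e (f * jt k (fun i => (b i)%:Z) * 'X_[expo (@nat_of_ord k)]) =
  wcoord N c e (f * 'X_[expo b]).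
Proof.
move=> symf; apply: (mulIf (fact_poly_neq0 k)); rewrite [LHS]mulr_natr [RHS]mulr_natr.
have symfj : f * jt k (fun i => (b i)%:Z) \is symmetric by rewrite rpredM ?jt_sym.
rewrite -(wcoord_sym_alternant N c e b symf).
by rewrite -(wcoord_sym_alternant N c e _ symfj) -mulrA -alternantE.
Qed.

Lemma poly_int_eqN_eq0 (x : R) : x = - x -> x = 0.
Proof. move=> xN; apply/polyP=> i; apply/eqP.
by rewrite coef0 -eqNr -coefN -xN.
Qed.

(** The transposition of i and j fixes the argument and changes the sign of the
    functional. *)
Lemma wcoord_eq0 N (c : R) k (e b : 'I_k -> nat) (i j : 'I_k) f :
  f \is symmetric -> i != j -> b i = b j -> wcoord N c e (f * 'X_[expo b]) = 0.
Proof.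
move=> symf neq_ij bij; apply: poly_int_eqN_eq0.
rewrite -{1}(_ : msym (tperm i j) (f * 'X_[expo b]) = f * 'X_[expo b]).
  by rewrite wcoord_msym odd_tperm neq_ij mulN1r.
rewrite msymM (issymP _ symf) msymX; congr (_ * 'X_[_]).
by apply/mnmP=> l; rewrite !mnmE tpermV; case: tpermP => // ->.
Qed.

(** * Partitions as strictly increasing sequences of positions *)

Section StrictlyIncreasing.
Variable k : nat.
Implicit Types e : 'I_k -> nat.

Definition increasing e := forall i j : 'I_k, (i < j)%N -> (e i < e j)%N.

Lemma increasing_mono e i j : increasing e -> (e i < e j)%N = (i < j)%N.
Proof.
move=> inc; case: (ltngtP i j) => [/inc //|/inc lt_ji|/val_inj ->]; last by rewrite ltnn.
by rewrite ltnNge ltnW.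
Qed.

Lemma increasing_inj e : increasing e -> injective e.
Proof.
move=> inc i j eij.
have [lt_ij|lt_ji|/val_inj //] := ltngtP i j.
  by have := inc _ _ lt_ij; rewrite eij ltnn.
by have := inc _ _ lt_ji; rewrite eij ltnn.
Qed.

Lemma increasing_gap e (i j : 'I_k) : increasing e -> (i <= j)%N ->
  (e i + (j - i) <= e j)%N.
Proof.
move=> inc; case: j => j; elim: j => [|j IHj] lt_jk /=.
  by rewrite leqn0 => /eqP i0; rewrite i0 addn0 (_ : Ordinal _ = i) //; apply: val_inj.
rewrite leq_eqVlt => /predU1P[ij|le_ij].
  by rewrite ij subnn addn0 (_ : Ordinal _ = i) //; apply: val_inj; rewrite /= ij.
have lt_jk' := ltnW lt_jk; have := IHj lt_jk' le_ij.
have := inc (Ordinal lt_jk') (Ordinal lt_jk) (ltnSn j); rewrite /=; lia.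
Qed.

Lemma increasing_sorted e : increasing e -> sorted ltn [seq e i | i <- enum 'I_k].
Proof.
move=> inc; rewrite sorted_map; apply: (@sub_sorted _ (relpre val ltn)).
  by move=> i j /=; apply: inc.
by rewrite -sorted_map val_enum_ord iota_ltn_sorted.
Qed.

(** Both enumerate the same k-element set in order. *)
Lemma increasing_eq e e' : increasing e -> increasing e' ->
  (forall i, exists j, e i = e' j) -> e =1 e'.
Proof.
move=> inc inc' sub_ee'.
have [] := @uniq_min_size _ [seq e i | i <- enum 'I_k] [seq e' i | i <- enum 'I_k].
- by rewrite (map_inj_uniq (increasing_inj inc)) enum_uniq.
- move=> _ /mapP[i _ ->]; have [j ->] := sub_ee' i.
  by apply: map_f; rewrite mem_enum.
- by rewrite !size_map.
move=> _ eq_mem.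
have eq_map := irr_sorted_eq ltn_trans ltnn (increasing_sorted inc)
  (increasing_sorted inc') eq_mem.
by move=> i; apply: ((eq_in_map _ _ _).2 eq_map); rewrite mem_enum.
Qed.

End StrictlyIncreasing.

Lemma increasing_lift k (e : 'I_k.+1 -> nat) i : increasing e -> increasing (e \o lift i).
Proof.
move=> inc j1 j2 lt_j; by apply: inc; rewrite /= ltnNge leq_bump2 -ltnNge.
Qed.

Section Boxpart.
Variables k n : nat.
Implicit Types la mu nu rho : boxpart k n.

Lemma part_out la i : (k <= i)%N -> part la i = 0%N.
Proof. by move=> le_ki; rewrite /part nth_default // size_map size_tuple. Qed.

Lemma part_ord la (i : 'I_k) : part la i = tnth (bptuple la) i.
Proof.
by rewrite /part (nth_map (tnth (bptuple la) i)) ?size_tuple // -tnth_nth.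
Qed.

Lemma part_le la i : (part la i <= n)%N.
Proof.
case: (ltnP i k) => [lt_ik|/part_out -> //].
by rewrite -[i]/(nat_of_ord (Ordinal lt_ik)) part_ord -ltnS ltn_ord.
Qed.

Lemma part_anti la i j : (i <= j)%N -> (part la j <= part la i)%N.
Proof.
move=> le_ij; case: (ltnP j k) => [lt_jk|/part_out -> //].
have geq_trans : transitive geq by move=> a b c /= ab bc; apply: leq_trans bc ab.
have geq_refl : reflexive geq by move=> a /=.
have := sorted_leq_nth geq_trans geq_refl 0%N (valP la).
by apply => //; rewrite inE size_map size_tuple //; apply: leq_ltn_trans lt_jk.
Qed.

Lemma boxpart_eq la mu : (forall i : 'I_k, part la i = part mu i) -> la = mu.
Proof.
move=> eq_p; apply: val_inj; apply: eq_from_tnth => i; apply: val_inj.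
by rewrite /= -!part_ord.
Qed.

Lemma boxpart_exists (a : nat -> nat) :
    (forall i j, (i <= j < k)%N -> (a j <= a i)%N) ->
    (forall i, (i < k)%N -> (a i <= n)%N) ->
  exists la : boxpart k n, forall i, (i < k)%N -> part la i = a i.
Proof.
move=> anti_a le_an; pose t : k.-tuple 'I_n.+1 := [tuple inord (a i) | i < k].
have valt : [seq val x | x <- t] = [seq a i | i <- iota 0 k].
  rewrite -val_enum_ord -!map_comp; apply/eq_in_map => i _ /=.
  by rewrite inordK // ltnS le_an.
have sorted_t : sorted geq [seq val x | x <- t].
  rewrite valt; apply: (path_sorted (x := n)); apply/(pathP 0%N) => i.
  rewrite size_map size_iota => lt_ik.
  rewrite (nth_map 0%N) ?size_iota // nth_iota // add0n.
  case: i lt_ik => [|i] lt_ik /=; first by apply: le_an.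
  rewrite (nth_map 0%N) ?size_iota ?nth_iota ?(ltnW lt_ik) // add0n.
  by apply: anti_a; rewrite leqnSn.
exists (BoxPart sorted_t) => i lt_ik.
by rewrite /part valt (nth_map 0%N) ?size_iota // nth_iota.
Qed.

(** Position, counted from 0, of the (i+1)-st one in the word of la. *)
Definition onepos la (i : 'I_k) : nat := (part la (k - i.+1) + i)%N.

Lemma onepos_increasing la : increasing (onepos la).
Proof.
move=> i j lt_ij; rewrite /onepos.
by have := @part_anti la (k - j.+1) (k - i.+1); have := ltn_ord j; lia.
Qed.

Lemma onepos_lt la i : (onepos la i < n + k)%N.
Proof. by rewrite /onepos; have := part_le la (k - i.+1); have := ltn_ord i; lia. Qed.

Lemma part_onepos la (i : 'I_k) : (part la i + (k - i.+1))%N = onepos la (rev_ord i).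
Proof. by rewrite /onepos /=; congr (part la _ + _)%N; have := ltn_ord i; lia. Qed.

Lemma onepos_inj la mu : onepos la =1 onepos mu -> la = mu.
Proof.
move=> eq_ex; apply: boxpart_eq => i.
by have := part_onepos la i; rewrite eq_ex -part_onepos => /addIn.
Qed.

Lemma onepos_exists (e : 'I_k -> nat) : increasing e -> (forall i, e i < n + k)%N ->
  exists la, onepos la =1 e.
Proof.
move=> inc lt_eN; pose e' i := oapp e 0%N (insub i : option 'I_k).
have e'E (i : 'I_k) : e' i = e i by rewrite /e' valK.
pose a i := (e' (k - i.+1) - (k - i.+1))%N.
have gap i j : (i <= j < k)%N -> (e' i + (j - i) <= e' j)%N.
  case/andP=> le_ij lt_jk; have lt_ik := leq_ltn_trans le_ij lt_jk.
  by have := @increasing_gap _ e (Ordinal lt_ik) (Ordinal lt_jk) inc le_ij; rewrite -!e'E.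
have e'_lt i : (i < k)%N -> (e' i < n + k)%N.
  by move=> lt_ik; rewrite -[i]/(nat_of_ord (Ordinal lt_ik)) e'E.
have [i j ij|i lt_ik|la laE] := @boxpart_exists a.
- have := gap (k - j.+1)%N (k - i.+1)%N; rewrite /a; lia.
- have := gap (k - i.+1)%N k.-1; have := e'_lt k.-1; rewrite /a; lia.
exists la => i; rewrite /onepos laE /a; last by have := ltn_ord i; lia.
have -> : (k - (k - i.+1).+1)%N = i by have := ltn_ord i; lia.
rewrite e'E subnK //; have := gap 0%N i; rewrite e'E ltn_ord; lia.
Qed.

Lemma nth_word la p : nth false (word la) p = [exists i, p == onepos la i].
Proof.
case: (ltnP p (n + k)) => [lt_pN|le_Np].
  rewrite nth_mkseq //; apply: eq_existsb => i.
  by rewrite /onepos addnS eqSS.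
rewrite nth_default ?size_mkseq //; apply/esym/existsP => -[i /eqP pE].
by have := onepos_lt la i; rewrite -pE ltnNge le_Np.
Qed.

Lemma count_word la b : (b <= n + k)%N ->
  count id (take b (word la)) = (\sum_(i < k) (onepos la i < b))%N.
Proof.
move=> le_bN; rewrite /word /mkseq -map_take take_iota (minn_idPl le_bN).
rewrite count_map -sum1_count big_mkcond /= -{1}[b]subn0 -/(index_iota 0 b).
transitivity (\sum_(0 <= p < b) \sum_(i < k) (p == onepos la i))%N.
  apply: eq_bigr => p _; case: ifP => [/existsP[i]|/negbT].
    rewrite addnS eqSS => /eqP pE; rewrite (bigD1 i) // big1 /=.
      by rewrite [in p == _]pE eqxx.
    move=> j neq_ji; rewrite pE; case: eqP => // /(increasing_inj (@onepos_increasing la)) ij.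
    by rewrite ij eqxx in neq_ji.
  rewrite negb_exists => /forallP np; rewrite big1 // => i _.
  by have := np i; rewrite addnS eqSS => /negbTE ->.
rewrite exchange_big; apply: eq_bigr => i _ /=.
case: ltnP => [lt_eb|le_be].
  rewrite (bigD1_seq (onepos la i)) ?iota_uniq ?mem_index_iota //= eqxx big1 // => p.
  by move/negbTE ->.
rewrite big_nat big1 // => p /andP[_ lt_pb].
by rewrite (ltn_eqF (leq_trans lt_pb le_be)).
Qed.

Lemma schur_jt la : schur la = jt k (fun i => (onepos la i)%:Z).
Proof.
rewrite /schur /jt; pose s := perm (@rev_ord_inj k).
set A := (X in \det X = _); pose B : 'M[{mpoly {poly int}[k]}]_k :=
  \matrix_(i < k, j < k) hsymz k ((onepos la i)%:Z - j%:Z).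
have -> : A = row_perm s (col_perm s B).
  apply/matrixP=> i j; rewrite !mxE !permE -part_onepos.
  by congr (hsymz _ _); rewrite /=; have := ltn_ord i; have := ltn_ord j; lia.
rewrite row_permE col_permE !det_mulmx !det_perm odd_permV.
by rewrite mulrCA -signr_addb addbb mulr1.
Qed.

Lemma sort_increasing (e : 'I_k -> nat) : injective e -> (forall i, e i < n + k)%N ->
  exists la (s : 'S_k), forall i, e i = onepos la (s i).
Proof.
move=> inj_e lt_eN; pose t := [tuple e i | i < k].
pose s0 := sort leq t.
have size_s0 : size s0 = k by rewrite size_sort size_tuple.
have sorted_s0 : sorted ltn s0.
  rewrite ltn_sorted_uniq_leq sort_sorted ?andbT; last exact: leq_total.
  by rewrite sort_uniq map_inj_uniq // enum_uniq.
pose t' := Tuple (introT eqP size_s0).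
have inc : increasing (fun i : 'I_k => tnth t' i).
  move=> i j lt_ij; rewrite !(tnth_nth 0%N) /=.
  by apply: (sorted_ltn_nth ltn_trans 0%N sorted_s0) => //; rewrite inE size_s0.
have mem_t' i : tnth t' i \in t by rewrite -(mem_sort leq) mem_tnth.
have [la laE] : exists la, onepos la =1 (fun i => tnth t' i).
  apply: onepos_exists => // i; have /tnthP[j ->] := mem_t' i.
  by rewrite tnth_mktuple.
have /tuple_permP[s tE] : perm_eq t t' by rewrite perm_sym perm_sort.
exists la, s => i; rewrite laE -[e i](tnth_mktuple e i).
by rewrite (tnth_nth 0%N) tE -tnth_nth tnth_mktuple.
Qed.

End Boxpart.

(** * The quantum relations and the structure constants *)

Section QuantumIdeal.
Variables k n : nat.
Local Notation N := (n + k)%N.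
Local Notation A := {mpoly R[k]}.
Local Notation ideal := (@in_qideal k n).
Implicit Types (p f : A) (e : 'I_k -> nat).

(** The value c of x^N for which the quantum relations act by zero. *)
Definition signed_q : R := (-1) ^+ k.+1 * 'X.

Lemma ideal0 : ideal 0.
Proof.
exists (fun=> 0) => [i|]; first by rewrite rpred0.
by rewrite big1 // => i _; rewrite mul0r.
Qed.

Lemma idealD p f : ideal p -> ideal f -> ideal (p + f).
Proof.
case=> a syma -> [b symb ->]; exists (fun i => a i + b i) => [i|].
  by rewrite rpredD.
by rewrite -big_split; apply: eq_bigr => i _; rewrite /= mulrDl.
Qed.

Lemma idealMl p f : f \is symmetric -> ideal p -> ideal (f * p).
Proof.
move=> symf [a syma ->]; exists (fun i => f * a i) => [i|].
  by rewrite rpredM.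
by rewrite mulr_sumr; apply: eq_bigr => i _; rewrite mulrA.
Qed.

Lemma symC (x : R) : x%:MP_[k] \is symmetric.
Proof. by apply/issymP=> s; rewrite /msym mmapC. Qed.

Lemma idealZ (x : R) p : ideal p -> ideal (x *: p).
Proof. by move=> Ip; rewrite -mul_mpolyC; apply: idealMl; rewrite ?symC. Qed.

Lemma idealN p : ideal p -> ideal (- p).
Proof. by rewrite -scaleN1r; apply: idealZ. Qed.

Lemma ideal_sum I (r : seq I) (P : pred I) (F : I -> A) :
  (forall i, P i -> ideal (F i)) -> ideal (\sum_(i <- r | P i) F i).
Proof. by move=> IF; elim/big_ind: _ => //; [apply: ideal0 | apply: idealD]. Qed.

Lemma size_qrelations : size (qrelations k n) = k.
Proof. by case: k => [|k'] //=; rewrite size_rcons size_map size_iota. Qed.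

Lemma nth_qrelations i : (i < k)%N -> (qrelations k n)`_i =
  hsym k (n.+1 + i) - (if i.+1 == k then signed_q%:MP else 0).
Proof.
rewrite /qrelations /signed_q; case: k => [|k'] // lt_ik.
rewrite nth_rcons size_map size_iota /= eqSS.
move: lt_ik; rewrite ltnS leq_eqVlt => /predU1P[->|lt_ik].
  rewrite ltnn eqxx addSnnS; congr (_ + _).
  by rewrite [in RHS]exprS mulN1r mulNr mpolyCN opprK mpolyCM rmorphXn rmorphN1.
by rewrite lt_ik (ltn_eqF lt_ik) (nth_map 0%N) ?size_iota // nth_iota // subr0.
Qed.

Lemma qrelation_ideal i : (i < k)%N ->
  ideal (hsym k (n.+1 + i) - (if i.+1 == k then signed_q%:MP else 0)).
Proof.
move=> lt_ik; exists (fun j => (j == i)%:R) => [j|]; first by rewrite rpred_nat.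
rewrite -nth_qrelations //; have lt_is : (i < size (qrelations k n))%N.
  by rewrite size_qrelations.
rewrite (bigD1 (Ordinal lt_is)) //= eqxx mul1r big1 ?addr0 // => j neq_j.
rewrite (_ : (_ == i) = false) ?mul0r //.
by apply: contraNF neq_j => /eqP ?; apply/eqP/val_inj.
Qed.

(** The exponents 0, .., k-2, r+k-1 belong to the one-row partition (r). *)
Lemma jt_hook (r : nat) (l : 'I_k) : l.+1 = k ->
  jt k (fun i => (if i == l then (r + l)%N else i)%:Z) = hsym k r.
Proof.
move=> lk; have le_l (i : 'I_k) : (i <= l)%N by rewrite -ltnS lk.
rewrite /jt det_trig; last first.
  apply/is_trig_mxP => i j lt_ij; rewrite mxE hsymz_neg //.
  case: eqP => [il|_]; last by lia.
  by have := le_l j; rewrite -il leqNgt lt_ij.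
rewrite (bigD1 l) //= mxE eqxx PoszD addrK big1 ?mulr1 // => i /negbTE neq_il.
by rewrite mxE neq_il subrr [LHS]hsym0.
Qed.

Hypothesis N_gt0 : (0 < N)%N.
Local Notation wc := (wcoord N signed_q).
Local Notation delta := (expo (@nat_of_ord k)).

(** Acting by h_r on the wedge of 1, .., x^(k-1) replaces the last exponent by
    r + k - 1. For n < r < N this is congruent modulo N to one of the other
    exponents, so the wedge vanishes; for r = N one gets c times the original
    wedge, which the term with q cancels. *)
Lemma ideal_wcoord e p : ideal p -> wc e (p * 'X_[delta]) = 0.
Proof.
case=> a syma ->; rewrite mulr_suml linear_sum big1 // => i _ /=.
have lt_ik : (i < k)%N by apply: leq_trans (ltn_ord i) _; rewrite size_qrelations.
have k_gt0 : (0 < k)%N by apply: leq_trans lt_ik.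
have lt_lk : (k.-1 < k)%N by rewrite prednK.
pose l := Ordinal lt_lk; have lk : l.+1 = k by rewrite /= prednK.
pose b (t : nat) (j : 'I_k) : nat := if j == l then t else j.
rewrite nth_qrelations // mulrBr mulrBl linearB /=.
rewrite -(@jt_hook _ l) // (wcoord_jt _ _ _ (b _)) //.
have -> : expo (b (n.+1 + i + l)%N) = (expo (b i) + U_(l) *+ N)%MM.
  apply/mnmP=> j; rewrite mnmDE mulmnE mnm1E !mnmE /b eq_sym.
  by case: eqP => _; rewrite /=; lia.
rewrite mpolyXD -mpolyXn mulrA wcoord_quasi //.
case: eqP => [ik|neq_ik].
  have -> : expo (b i) = delta.
    apply: eq_expo => j; rewrite /b; case: eqP => // ->.
    by apply/eqP; rewrite -eqSS lk ik.
  by rewrite [a i * _%:MP]mulrC mul_mpolyC -scalerAl linearZ /= subrr.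
rewrite mulr0 mul0r linear0 subr0.
have neq_li : l != Ordinal lt_ik.
  by apply/eqP=> li; apply: neq_ik; apply: etrans lk; rewrite li.
rewrite (wcoord_eq0 _ _ _ _ neq_li) ?mulr0 //.
by rewrite /b eqxx eq_sym (negbTE neq_li).
Qed.

(** The window h_(n+1), .., h_N is c times the window h_(1-k), .., h_0 by the
    relations themselves, and both windows are continued by the same recursion
    of order k. *)
Lemma hsymz_shift (z : int) : (0 < k)%N -> 1 - k%:Z <= z ->
  ideal (hsymz k (N%:Z + z) - signed_q *: hsymz k z).
Proof.
move=> k_gt0 lb_z.
have [m ->] : exists m : nat, z = m%:Z + 1 - k%:Z.
  by exists `|(z + k%:Z - 1)%R|%N; lia.
elim/ltn_ind: m => m IHm {z lb_z}.
case: (ltnP m k) => [lt_mk|le_km].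
  have := qrelation_ideal lt_mk.
  have -> : N%:Z + (m%:Z + 1 - k%:Z) = (n.+1 + m)%N by lia.
  case: eqP => [mk|/eqP neq_mk].
    have -> : m%:Z + 1 - k%:Z = 0%N by lia.
    by rewrite /= hsym0 -mul_mpolyC mulr1.
  by rewrite [hsymz k (_ - _)]hsymz_neg ?scaler0 //; lia.
have [c [c0 symc cE]] := vieta k.
have recE (z : int) : z != 0 ->
    hsymz k z = - \sum_(i < k) c i.+1 * hsymz k (z - i.+1%:Z).
  move=> nz_z; have := cE z; rewrite (negbTE nz_z) big_ord_recl c0 mul1r subr0.
  by move/eqP; rewrite addr_eq0 => /eqP.
rewrite !recE; try lia.
rewrite scalerN -opprD; apply: idealN.
rewrite scaler_sumr -sumrB; apply: ideal_sum => i _.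
rewrite scalerAr -mulrBr; apply: idealMl; first by apply: (symc (lift ord0 i)).
have -> : N%:Z + (m%:Z + 1 - k%:Z) - i.+1%:Z = N%:Z + ((m - i.+1)%N%:Z + 1 - k%:Z).
  by have := ltn_ord i; lia.
have -> : m%:Z + 1 - k%:Z - i.+1%:Z = (m - i.+1)%N%:Z + 1 - k%:Z.
  by have := ltn_ord i; lia.
by apply: IHm; have := ltn_ord i; lia.
Qed.

(** Expansion along row i, whose entries are all congruent to c times the shifted
    ones. *)
Lemma jt_shift (a b : 'I_k -> nat) (i : 'I_k) :
    b i = (N + a i)%N -> (forall j, j != i -> b j = a j) ->
  ideal (jt k (fun j => (b j)%:Z) - signed_q *: jt k (fun j => (a j)%:Z)).
Proof.
move=> bi bj; have k_gt0 : (0 < k)%N by apply: leq_trans (ltn_ord i).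
rewrite /jt !(expand_det_row _ i) scaler_sumr -sumrB; apply: ideal_sum => j _.
set A := \matrix_(_, _) _; set B := \matrix_(_, _) _.
have -> : cofactor A i j = cofactor B i j.
  rewrite /cofactor; congr (_ * \det _); apply/matrixP=> r s.
  by rewrite !mxE bj // eq_sym neq_lift.
rewrite !mxE scalerAl -mulrBl mulrC; apply: idealMl.
  rewrite /cofactor rpredMsign rpred_sum // => s _.
  by rewrite rpredMsign rpred_prod // => r _; rewrite !mxE hsymz_sym.
have -> : (b i)%:Z - j%:Z = N%:Z + ((a i)%:Z - j%:Z) by rewrite bi; lia.
by apply: hsymz_shift => //; have := ltn_ord j; lia.
Qed.

(** Distinct sets of positions differ in an element, which gives a zero row. *)
Lemma wcoordm_onepos (c : R) (la nu : boxpart k n) :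
  wcoordm N c (onepos nu) (expo (onepos la)) = (la == nu)%:R.
Proof.
case: eqP => [->|neq_la_nu].
  apply: wcoordm_diag => [|i]; last exact: onepos_lt.
  exact/increasing_inj/onepos_increasing.
have /existsP[i /forallP ni] : [exists i, forall j, onepos la i != onepos nu j].
  apply: contra_notT neq_la_nu; rewrite negb_exists => /forallP all_i.
  apply/onepos_inj/increasing_eq; try exact: onepos_increasing.
  move=> i; have := all_i i; rewrite negb_forall => /existsP[j].
  by rewrite negbK => /eqP ij; exists j.
rewrite /wcoordm (expand_det_row _ i) big1 // => j _.
by rewrite mxE mnmE coord_small ?onepos_lt // (negbTE (ni j)) mul0r.
Qed.

(** Reducing exponents modulo N, discarding repeated ones and sorting affect the
    Jacobi-Trudi determinant modulo the ideal and the wedge in the same way. *)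
Lemma jt_reduce (a : 'I_k -> nat) :
  ideal (jt k (fun i => (a i)%:Z) -
         \sum_(nu : boxpart k n) wcoordm N signed_q (onepos nu) (expo a) *: schur nu).
Proof.
(* reducing an exponent modulo N lowers the sum of the exponents *)
move: {2}(\sum_i a i)%N (leqnn (\sum_i a i)%N) => d; elim/ltn_ind: d a => d IHd a le_d.
have [/existsP[i le_Na]|] := boolP [exists i, N <= a i]%N.
  pose a' j := if j == i then (a i - N)%N else a j.
  have ai : a i = (N + a' i)%N by rewrite /a' eqxx subnKC.
  have aj j : j != i -> a j = a' j by rewrite /a' => /negbTE ->.
  have lt_d : (\sum_i a' i < d)%N.
    apply: leq_trans le_d; rewrite (bigD1 i) // [X in (_ < X)%N](bigD1 i) //=.
    rewrite (eq_bigr a) => [|j /aj //]; rewrite ltn_add2r /a' eqxx; lia.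
  have I' := idealZ signed_q (IHd _ lt_d a' (leqnn _)).
  have := idealD (jt_shift ai aj) I'; congr ideal.
  rewrite scalerBr addrA subrK; congr (_ - _); rewrite scaler_sumr.
  apply: eq_bigr => nu _; rewrite scalerA; congr (_ *: _).
  rewrite -[wcoordm N signed_q (onepos nu) (expo a)](linextX _) -/(wcoord _ _ _ _).
  have -> : expo a = (expo a' + U_(i) *+ N)%MM.
    apply/mnmP=> j; rewrite mnmDE mulmnE mnm1E !mnmE eq_sym.
    by case: eqP => [->|/eqP/aj ->]; rewrite ?mul0n ?addn0 // mul1n ai addnC.
  by rewrite mpolyXD -mpolyXn wcoord_quasi // /wcoord linextX.
rewrite negb_exists => /forallP lt_aN.
have {}lt_aN i : (a i < N)%N by rewrite ltnNge lt_aN.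
have [/injectiveP inj_a|/injectivePn[i [j neq_ij aij]]] := boolP (injectiveb a); last first.
  rewrite /jt (determinant_alternate neq_ij) => [|r]; last by rewrite !mxE aij.
  rewrite big1 ?subr0 => [|nu _]; first exact: ideal0.
  rewrite /wcoordm (determinant_alternate neq_ij) ?scale0r // => r.
  by rewrite !mxE !mnmE aij.
have [la [s aE]] := sort_increasing inj_a lt_aN.
rewrite (bigD1 la) //= big1 ?addr0 => [|nu neq_nu].
  have -> : expo a = [multinom (expo (onepos la)) (s i) | i < k].
    by apply/mnmP=> i; rewrite !mnmE aE.
  rewrite wcoordmP wcoordm_onepos eqxx mulr1 schur_jt.
  have -> : jt k (fun i => (a i)%:Z) = (-1) ^+ s *: jt k (fun i => (onepos la i)%:Z).
    rewrite /jt -mul_mpolyC rmorphXn rmorphN1 -det_perm -det_mulmx -row_permE.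
    by congr (\det _); apply/matrixP=> i j; rewrite !mxE aE.
  by rewrite subrr; apply: ideal0.
have -> : expo a = [multinom (expo (onepos la)) (s i) | i < k].
  by apply/mnmP=> i; rewrite !mnmE aE.
by rewrite wcoordmP wcoordm_onepos eq_sym (negbTE neq_nu) mulr0 scale0r.
Qed.

(** Existence of the expansion in the Schur basis, with explicit coefficients. *)
Lemma ideal_expansion f : f \is symmetric ->
  ideal (f - \sum_(nu : boxpart k n) wc (onepos nu) (f * 'X_[delta]) *: schur nu).
Proof.
move=> symf; rewrite {1}(sym_jtE symf).
rewrite [X in _ - X](eq_bigr (fun nu => \sum_(m <- msupp f)
  (f@_m * wcoordm N signed_q (onepos nu) (m + delta)) *: schur nu)) => [|nu _]; last first.
  by rewrite -scaler_suml; congr (_ *: _); apply: linextMX.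
rewrite exchange_big -sumrB; apply: ideal_sum => m _ /=.
under eq_bigr => nu _ do rewrite -scalerA.
rewrite -scaler_sumr -scalerBr; apply: idealZ.
have := jt_reduce (fun i => (m i + i)%N); congr (ideal (_ - _)).
apply: eq_bigr => nu _; congr (wcoordm _ _ _ _ *: _).
by apply/mnmP=> i; rewrite mnmDE !mnmE.
Qed.

Lemma schur_sym (la : boxpart k n) : schur la \is symmetric.
Proof. by rewrite schur_jt jt_sym. Qed.

(** Since s_mu maps the wedge of 1, .., x^(k-1) to v_mu. *)
Lemma wcoord_schur (M : nat) (c : R) e f (mu : boxpart k n) : f \is symmetric ->
  wcoord M c e (f * schur mu * 'X_[delta]) = wcoord M c e (f * 'X_[expo (onepos mu)]).
Proof. by move=> symf; rewrite schur_jt wcoord_jt. Qed.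

(** Uniqueness of the expansion: the functional at nu vanishes on the ideal and
    picks out the coefficient of s_nu. *)
Lemma qexpansionE (la mu nu : boxpart k n) :
  qexpansion la mu nu = wc (onepos nu) (schur la * 'X_[expo (onepos mu)]).
Proof.
have symsl : schur la * schur mu \is symmetric by rewrite rpredM ?schur_sym.
have : is_qexpansion la mu (qexpansion la mu).
  apply: epsilon_spec.
  exists (fun nu => wc (onepos nu) (schur la * schur mu * 'X_[delta])).
  exact: ideal_expansion.
move/ideal_wcoord => /(_ (onepos nu)) /eqP.
rewrite mulrBl linearB /= subr_eq0 wcoord_schur ?schur_sym // => /eqP ->.
rewrite mulr_suml linear_sum /= (bigD1 nu) //= big1 ?addr0 => [|nu' neq_nu].
  rewrite -scalerAl linearZ /= -[schur nu]mul1r wcoord_schur ?rpred1 //.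
  by rewrite mul1r /wcoord linextX wcoordm_onepos eqxx mulr1.
rewrite -scalerAl linearZ /= -[schur nu']mul1r wcoord_schur ?rpred1 //.
by rewrite mul1r /wcoord linextX wcoordm_onepos (negbTE neq_nu) mulr0.
Qed.

End QuantumIdeal.

(** * Vertical and horizontal strips *)

(** Multilinearity in the rows. *)
Lemma det_distr (S : comNzRingType) l M (w : 'I_l -> 'I_M -> S) (H : 'I_M -> 'I_l -> S) :
  \det (\matrix_(i, j) \sum_b w i b * H b j) =
  \sum_(b : {ffun 'I_l -> 'I_M}) (\prod_i w i (b i)) * \det (\matrix_(i, j) H (b i) j).
Proof.
rewrite /determinant.
under eq_bigr => s _ do
  (under eq_bigr => i _ do rewrite mxE; rewrite bigA_distr_bigA mulr_sumr).
rewrite exchange_big; apply: eq_bigr => b _ /=; rewrite mulr_sumr.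
apply: eq_bigr => s _; rewrite mulrCA big_split; congr (_ * (_ * _)).
by apply: eq_bigr => i _; rewrite mxE.
Qed.

Lemma sum_delta (S : comNzRingType) M (F : nat -> S) (e : nat) :
  (e < M)%N -> \sum_(b < M) (b == e :> nat)%:R * F b = F e.
Proof.
move=> lt_eM; rewrite (bigD1 (Ordinal lt_eM)) //= eqxx mul1r big1 ?addr0 // => b.
by rewrite -val_eqE /= => /negbTE ->; rewrite mul0r.
Qed.

Lemma sum_by_size (V : nmodType) (I : finType) (P : I -> nat -> bool) (Q : pred I)
    (d : I -> nat) (D : nat) (F : I -> nat -> V) :
    (forall x r, P x r = Q x && (d x == r)) -> (forall x, Q x -> d x <= D)%N ->
  \sum_(0 <= r < D.+1) \sum_(x | P x r) F x r = \sum_(x | Q x) F x (d x).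
Proof.
move=> PE le_dD; under eq_bigr => r _ do rewrite big_mkcond.
rewrite exchange_big [RHS]big_mkcond; apply: eq_bigr => x _ /=.
case: ifP => Qx; last by rewrite big1 // => r _; rewrite PE Qx.
rewrite (bigD1_seq (d x)) ?iota_uniq ?mem_index_iota ?ltnS ?le_dD //=.
rewrite PE Qx eqxx big1 ?addr0 // => r; rewrite PE Qx eq_sym /=.
by move/negbTE ->.
Qed.

Section Strips.
Variables k n : nat.
Local Notation N := (n + k)%N.
Implicit Types la rho : boxpart k n.

(** The positions of the ones, in the finite type over which [det_distr] sums. *)
Definition onepos_ffun rho : {ffun 'I_k -> 'I_N} := [ffun i => Ordinal (onepos_lt rho i)].

(** A partition is the same as its increasing sequence of positions. *)
Lemma sum_increasing (V : nmodType) (T : {ffun 'I_k -> 'I_N} -> V) :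
    (forall b : {ffun 'I_k -> 'I_N}, ~ increasing (fun i => b i : nat) -> T b = 0) ->
  \sum_b T b = \sum_rho T (onepos_ffun rho).
Proof.
move=> T0; have onepos_ffun_inj : injective onepos_ffun.
  move=> rho rho' /ffunP eq_rho; apply: onepos_inj => i.
  by have := congr1 val (eq_rho i); rewrite !ffunE.
rewrite -(big_imset T (in2W onepos_ffun_inj)) [RHS]big_mkcond; apply: eq_bigr => b _ /=.
case: ifPn => // b_out; apply: T0 => inc_b; case/imsetP: b_out.
have [rho rhoE] := @onepos_exists k n _ inc_b (fun i => ltn_ord (b i)).
by exists rho => //; apply/ffunP=> i; apply: val_inj; rewrite ffunE /= rhoE.
Qed.

Definition skew_size la rho : nat := \sum_(i < k) (onepos la i - onepos rho i).

Lemma part_sub_onepos la rho (i : 'I_k) :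
  (part rho i <= part la i)%N = (onepos rho (rev_ord i) <= onepos la (rev_ord i))%N.
Proof. by rewrite -!part_onepos leq_add2r. Qed.

Lemma psubE la rho : psub rho la = [forall i, onepos rho i <= onepos la i]%N.
Proof.
apply/forallP/forallP => le_rl i; last by rewrite part_sub_onepos.
by rewrite -[i]rev_ordK -part_sub_onepos.
Qed.

Lemma sum_between a b m : (\sum_(j < m) (a <= j < b) = minn b m - a)%N.
Proof.
elim: m => [|m IHm]; first by rewrite big_ord0 minn0.
by rewrite big_ord_recr IHm /=; lia.
Qed.

Lemma card_skew la rho : #|Defs.skew la rho| = skew_size la rho.
Proof.
rewrite -sum1_card big_mkcond /=.
transitivity (\sum_(i < k) \sum_(j < n) (part rho i <= j < part la i))%N.
  by rewrite pair_bigA; apply: eq_bigr => -[i j] _; rewrite inE; case: ifP.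
rewrite /skew_size (reindex_inj rev_ord_inj) /=; apply: eq_bigr => i _.
rewrite sum_between (minn_idPl (part_le _ _)).
have := part_onepos la (rev_ord i); have := part_onepos rho (rev_ord i).
by rewrite rev_ordK /=; lia.
Qed.

Definition vertical_strip la rho := [forall i, onepos rho i <= onepos la i <= (onepos rho i).+1]%N.

(** In terms of positions a horizontal strip is an interlacing: each one of rho
    lies above the preceding one of la. *)
Definition horizontal_strip la rho :=
  [forall i : 'I_k, (onepos rho i <= onepos la i)%N &&
    [forall j : 'I_k, (j < i)%N ==> (onepos la j < onepos rho i)%N]].

Lemma vstripE la rho r : vstrip la rho r = vertical_strip la rho && (skew_size la rho == r).
Proof.
rewrite /vstrip psubE card_skew andbCA [RHS]andbC; congr (_ && _).
apply/andP/forallP => [[/forallP le_rl /dinjectiveP inj_row] i|vert_i].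
  rewrite le_rl leqNgt; apply/negP => lt_rl.
  have lt2 : (part rho (rev_ord i) + 1 < part la (rev_ord i))%N.
    have := part_onepos la (rev_ord i); have := part_onepos rho (rev_ord i).
    by rewrite rev_ordK /=; lia.
  have le_n := part_le la (rev_ord i).
  rewrite /= in lt2 le_n.
  have lt0n : (part rho (k - i.+1) < n)%N by lia.
  have lt1n : (part rho (k - i.+1) + 1 < n)%N by lia.
  pose b0 := (rev_ord i, Ordinal lt0n); pose b1 := (rev_ord i, Ordinal lt1n).
  have : b0 = b1 by apply: inj_row => //; rewrite inE /= ?leqnn; lia.
  by case=> eq01; have := eq01; lia.
split; first by apply/forallP => i; have /andP[] := vert_i i.
apply/dinjectiveP => -[i j] [i' j']; rewrite !inE /= => bj bj' eq_i; subst i'.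
congr (_, _); apply: val_inj => /=.
have := vert_i (rev_ord i); rewrite -!part_onepos; lia.
Qed.

Lemma horiz_part la rho (i j : 'I_k) :
  horizontal_strip la rho -> (i < j)%N -> (part la j <= part rho i)%N.
Proof.
move=> /forallP hor lt_ij; have lt_i1k : (i.+1 < k)%N by apply: leq_trans (ltn_ord j).
pose i1 := Ordinal lt_i1k.
have /andP[_ /forallP/(_ (rev_ord i1))] := hor (rev_ord i).
rewrite -!part_onepos /=; have := @part_anti _ _ la i1 j lt_ij; rewrite /=; lia.
Qed.

Lemma hstripE la rho r : hstrip la rho r = horizontal_strip la rho && (skew_size la rho == r).
Proof.
rewrite /hstrip psubE card_skew andbCA [RHS]andbC; congr (_ && _).
apply/andP/idP => [[/forallP le_rl /dinjectiveP inj_col]|hor].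
  apply/forallP => i; rewrite le_rl; apply/forallP => j; apply/implyP => lt_ji.
  rewrite ltnNge; apply/negP => le_rl'.
  have pla := part_onepos la (rev_ord j); have prho := part_onepos rho (rev_ord i).
  rewrite rev_ordK in pla; rewrite rev_ordK in prho.
  have lt_rij : (rev_ord i < rev_ord j)%N by rewrite /=; have := ltn_ord i; lia.
  have an1 := part_anti la (ltnW lt_rij).
  have an2 := part_anti rho (ltnW lt_rij).
  have le_n := part_le la (rev_ord j).
  have ri_lt_lj : (part rho (rev_ord i) < part la (rev_ord j))%N.
    by move: pla prho; rewrite /=; have := ltn_ord i; lia.
  (* the last box of the lower row has a box of the strip above it *)
  have lt_cn : ((part la (rev_ord j)).-1 < n)%N by lia.
  have : (rev_ord i, Ordinal lt_cn) = (rev_ord j, Ordinal lt_cn).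
    apply: inj_col => //; rewrite inE;
      move: an1 an2 ri_lt_lj (le_rl (rev_ord i)) (le_rl (rev_ord j)); rewrite /=; lia.
  by case=> eq_ij; move: lt_rij; rewrite /=; lia.
split; first by apply/forallP => i; have /andP[] := forallP hor i.
apply/dinjectiveP => -[i c] [j c']; rewrite !inE /= => bi bj eq_c; subst c'.
have [lt_ij|lt_ji|eq_ij] := ltngtP i j; last by congr (_, _); apply: val_inj.
  by have := horiz_part hor lt_ij; lia.
by have := horiz_part hor lt_ji; lia.
Qed.

Lemma skew_size_part la rho :
  skew_size la rho = (\sum_(i < k) (part la i - part rho i))%N.
Proof.
rewrite /skew_size (reindex_inj rev_ord_inj) /=; apply: eq_bigr => i _.
by have := part_onepos la i; have := part_onepos rho i; lia.
Qed.

Lemma vert_size la rho : vertical_strip la rho -> (skew_size la rho <= plength la)%N.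
Proof.
move=> /forallP ver.
have -> : plength la = (\sum_(i < k) (0 < part la i))%N.
  rewrite /plength /nonzero_parts size_filter -sum1_count big_map big_mkcond /=.
  by rewrite big_tuple; apply: eq_bigr => i _; rewrite part_ord; case: posnP.
rewrite skew_size_part; apply: leq_sum => i _.
by have := ver (rev_ord i); rewrite -!part_onepos; lia.
Qed.

Lemma horiz_size la rho : horizontal_strip la rho -> (skew_size la rho <= part la 0)%N.
Proof.
move=> hor.
have le_tail l : (l <= k)%N ->
    (\sum_(i < l) (part la i - part rho i) <=
      part la 0 - (if l is l'.+1 then part rho l' else part la 0))%N.
  elim: l => [|l IHl] lt_lk; first by rewrite big_ord0.
  have /andP[le_l _] := forallP hor (rev_ord (Ordinal lt_lk)).
  rewrite -!part_onepos /= leq_add2r in le_l.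
  have := IHl (ltnW lt_lk); rewrite big_ord_recr /=.
  case: l lt_lk le_l {IHl} => [|l] lt_lk le_l.
    by rewrite big_ord0 add0n; lia.
  have := horiz_part (i := Ordinal (ltnW lt_lk)) (j := Ordinal lt_lk) hor (ltnSn l).
  have := part_anti la (leq0n l); rewrite /=.
  have := part_anti la (leq0n l.+1); have := part_anti rho (leqnSn l); lia.
rewrite skew_size_part; apply: leq_trans (le_tail k (leqnn k)) _; exact: leq_subr.
Qed.

End Strips.

(** * Branching rules *)

Section Branching.
Variables k n : nat.
Local Notation N := (n + k)%N.
Implicit Types la rho : boxpart k n.

Lemma prod_if_expr (S : comNzRingType) (I : finType) (P : pred I) (x : S) (F : I -> nat) :
  \prod_i (if P i then x ^+ F i else 0) = if [forall i, P i] then x ^+ (\sum_i F i)%N else 0.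
Proof.
case: ifPn => [/forallP allP|]; first by rewrite -prodrXr; apply: eq_bigr => i _; rewrite allP.
by rewrite negb_forall => /existsP[i /negbTE Pi]; rewrite (bigD1 i) //= Pi mul0r.
Qed.

Lemma jt_rmorph (A : comNzRingType) (f : {rmorphism {mpoly R[k]} -> A}) l (a : 'I_l -> int) :
  f (jt k a) = \det (\matrix_(i, j) f (hsymz k (a i - j%:Z))).
Proof.
rewrite /jt -det_map_mx; congr (\det _); apply/matrixP=> i j; by rewrite !mxE.
Qed.

(** Each row of the determinant is h_e(all) - x_p h_(e-1)(all) by [hsymz_skip].
    Expanding all rows, every position stays or moves down by one; if the result
    is no longer strictly increasing then two rows agree. *)
Lemma schur_vertical_branching (p : 'I_k.+1) la :
  skipvar p (schur la) =
  \sum_(rho | vertical_strip la rho) (- 'X_p) ^+ skew_size la rho * jt k.+1 (fun i => (onepos rho i)%:Z).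
Proof.
pose y : {mpoly R[k.+1]} := 'X_p.
pose w (i : 'I_k) (b : 'I_N) : {mpoly R[k.+1]} :=
  (nat_of_ord b == onepos la i)%:R - y * (b.+1 == onepos la i)%:R.
pose H (b : 'I_N) (j : 'I_k) := hsymz k.+1 (b%:Z - j%:Z).
have wP i b : w i b = if (b <= onepos la i <= b.+1)%N then (- y) ^+ (onepos la i - b) else 0.
  rewrite /w; case: eqP => [bE|neq_b].
    by rewrite -bE leqnn leqnSn subnn expr0 gtn_eqF ?mulr0 ?subr0.
  case: eqP => [<-|neq_b']; first by rewrite leqnn leqnSn subSnn expr1 mulr1 sub0r.
  by rewrite mulr0 subr0; case: ifP => //; lia.
rewrite schur_jt jt_rmorph.
have -> : \matrix_(i, j) skipvar p (hsymz k ((onepos la i)%:Z - j%:Z)) =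
    \matrix_(i < k, j < k) \sum_b w i b * H b j.
  apply/matrixP=> i j; rewrite !mxE.
  under eq_bigr => b _ do rewrite /w mulrBl -mulrA.
  rewrite sumrB -mulr_sumr (sum_delta (fun b => hsymz k.+1 (b%:Z - j%:Z))) ?onepos_lt //.
  rewrite [in RHS](hsymz_skip p) -addrA; apply/esym/eqP; rewrite -subr_eq0 addrAC subrr add0r.
  rewrite subr_eq0; apply/eqP; congr (_ * _).
  case: (onepos la i) (onepos_lt la i) => [|e] lt_eN.
    by rewrite big1 ?hsymz_neg // => [|b _]; [lia | rewrite mul0r].
  under eq_bigr => b _ do rewrite eqSS.
  rewrite (sum_delta (fun b => hsymz k.+1 (b%:Z - j%:Z))) ?(ltnW lt_eN) //.
  by congr hsymz; lia.
rewrite det_distr sum_increasing => [|b not_inc]; last first.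
  have [/existsP[i out_i]|] := boolP [exists i, ~~ (b i <= onepos la i <= (b i).+1)%N].
    by rewrite (bigD1 i) //= wP (negbTE out_i) !mul0r.
  rewrite negb_exists => /forallP in_b.
  have {}in_b i : (b i <= onepos la i <= (b i).+1)%N by have := in_b i; rewrite negbK.
  suff [i [j [neq_ij bij]]] : exists i j : 'I_k, i != j /\ b i = b j.
    by rewrite (determinant_alternate neq_ij) ?mulr0 // => r; rewrite !mxE bij.
  have [/existsP[i /existsP[j /andP[neq_ij /eqP bij]]]|] :=
    boolP [exists i, exists j, (i != j) && (b i == b j)]; first by exists i, j.
  move/existsPn => no_eq; case: not_inc => i j lt_ij.
  have := @onepos_increasing _ _ la i j lt_ij; have := in_b i; have := in_b j.
  have /existsPn/(_ j) := no_eq i; rewrite -val_eqE (ltn_eqF lt_ij) /= -val_eqE /=; lia.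
rewrite [RHS]big_mkcond; apply: eq_bigr => rho _.
under eq_bigr => i _ do rewrite wP ffunE /=.
have -> : \det (\matrix_(i, j) H (onepos_ffun rho i) j) = jt k.+1 (fun i => (onepos rho i)%:Z).
  by congr (\det _); apply/matrixP=> i j; rewrite !mxE /H ffunE.
by rewrite prod_if_expr /vertical_strip; case: ifP; rewrite ?mul0r.
Qed.

End Branching.

(** Iteration of [hsymz_skip]. *)
Lemma hsymz_sum_skip k (p : 'I_k.+1) (M a : nat) (j : nat) : (a < M)%N ->
  hsymz k.+1 (a%:Z - j%:Z) =
  \sum_(b < M) (if (b <= a)%N then 'X_p ^+ (a - b) else 0) * skipvar p (hsymz k (b%:Z - j%:Z)).
Proof.
elim: a => [|a IHa] lt_aM.
  rewrite (bigD1 (Ordinal lt_aM)) //= expr0 mul1r big1 => [|b].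
    by rewrite addr0 (hsymz_skip p) [hsymz k.+1 _]hsymz_neg ?mulr0 ?addr0 //; lia.
  by rewrite -val_eqE /= leqn0 => /negbTE ->; rewrite mul0r.
rewrite (hsymz_skip p) (_ : a.+1%:Z - j%:Z - 1 = a%:Z - j%:Z); last by lia.
rewrite (IHa (ltnW lt_aM)) [RHS](bigD1 (Ordinal lt_aM)) //= leqnn subnn expr0 mul1r.
congr (_ + _); rewrite (bigD1 (Ordinal lt_aM)) //= ltnn mul0r add0r mulr_sumr.
apply: eq_bigr => b; rewrite -val_eqE /= => neq_b; rewrite mulrA.
case: (leqP b a) => [le_ba|lt_ab]; last first.
  by rewrite leq_eqVlt (negbTE neq_b) ltnS leqNgt lt_ab mulr0.
by rewrite (leqW le_ba) subSn // exprS.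
Qed.

Section HorizontalBranching.
Variables k n : nat.
Local Notation N := (n + k.+1)%N.
Implicit Types la rho : boxpart k.+1 n.

(** The positions of rho allowed in row i by the interlacing start right above
    the one of la that precedes row i. *)
Definition row_floor la (i : 'I_k.+1) : nat :=
  if i == 0%N :> nat then 0%N else (onepos la (inord i.-1)).+1.

Lemma horizE la rho :
  horizontal_strip la rho = [forall i, row_floor la i <= onepos rho i <= onepos la i]%N.
Proof.
apply: eq_forallb => i; rewrite andbC /row_floor; case: ifP => [/eqP i0|/negbT nz_i].
  by rewrite andbC (_ : [forall j, _] = true) ?andbT //; apply/forallP => j; rewrite i0.
have pre_lt : (@inord k i.-1 < i)%N by rewrite inordK; have := ltn_ord i; lia.
congr (_ && _); apply/forallP/idP => [/(_ (inord i.-1))|lt_i j]; first by rewrite pre_lt.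
apply/implyP => lt_ji; apply: leq_trans lt_i; rewrite ltnS.
have le_j : (j <= @inord k i.-1)%N by rewrite inordK; have := ltn_ord i; lia.
by have := increasing_gap (@onepos_increasing _ _ la) le_j; lia.
Qed.

(** By [hsymz_sum_skip] the row of e is the sum of x_p^(e-b) times the row of b in
    the other variables, over all b up to e. Subtracting from each row a suitable
    multiple of the preceding one cuts this sum down to the interlacing
    positions, so that the multilinear expansion gives exactly the horizontal
    strips. *)
Lemma schur_horizontal_branching (p : 'I_k.+1) la :
  schur la =
  \sum_(rho | horizontal_strip la rho) 'X_p ^+ skew_size la rho *
    skipvar p (jt k (fun i => (onepos rho i)%:Z)).
Proof.
pose y : {mpoly R[k.+1]} := 'X_p.
pose w (i : 'I_k.+1) (b : 'I_N) : {mpoly R[k.+1]} :=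
  if (row_floor la i <= b <= onepos la i)%N then y ^+ (onepos la i - b) else 0.
pose H (b : 'I_N) (j : 'I_k.+1) := skipvar p (hsymz k (b%:Z - j%:Z)).
pose A := \matrix_(i < k.+1, j < k.+1) hsymz k.+1 ((onepos la i)%:Z - j%:Z).
(* the row operations, chosen to cancel the terms b <= onepos la (i - 1) of row i *)
pose D : 'M[{mpoly R[k.+1]}]_k.+1 := \matrix_(i, j)
  ((j == i)%:R - if j.+1 == i then y ^+ (onepos la i - onepos la j) else 0).
have detD : \det D = 1.
  rewrite det_trig => [|]; last first.
    apply/is_trig_mxP => i j lt_ij; rewrite mxE -val_eqE /= gtn_eqF // gtn_eqF ?subr0 //.
    exact: leqW.
  by rewrite big1 // => i _; rewrite mxE eqxx gtn_eqF ?subr0.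
have DA : D *m A = \matrix_(i, j) \sum_b w i b * H b j.
  apply/matrixP=> i j; rewrite !mxE.
  under eq_bigr => r _ do rewrite !mxE mulrBl.
  rewrite sumrB (bigD1 i) //= eqxx mul1r big1 ?addr0 => [|r /negbTE ->]; last by rewrite mul0r.
  rewrite (hsymz_sum_skip p _ (onepos_lt la i)) /w /row_floor.
  have [i0|nz_i] := eqVneq (i : nat) 0%N.
    by rewrite [X in _ - X]big1 ?subr0 // => r _; rewrite i0 mul0r.
  have preK : (@inord k i.-1).+1 = i by rewrite inordK; have := ltn_ord i; lia.
  rewrite (bigD1 (inord i.-1)) //= preK eqxx [X in _ - (_ + X)]big1 ?addr0 => [|r]; last first.
    rewrite -val_eqE -eqSS preK => /negbTE; rewrite /= => ->; by rewrite mul0r.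
  set e' := onepos la (inord i.-1).
  have lt_e' : (e' < onepos la i)%N by apply: onepos_increasing; rewrite -ltnS preK.
  rewrite (hsymz_sum_skip p _ (onepos_lt la _)) mulr_sumr -sumrB; apply: eq_bigr => b _.
  rewrite mulrA -mulrBl -/e'; congr (_ * _).
  case: (leqP b e') => [le_be|lt_eb]; last by rewrite mulr0 subr0.
  rewrite (leq_trans le_be (ltnW lt_e')) /= -exprD.
  by rewrite (_ : (_ - e' + _ = onepos la i - b)%N) ?subrr //; lia.
rewrite schur_jt -[LHS]mul1r -detD /jt -det_mulmx DA det_distr.
rewrite sum_increasing => [|b not_inc]; last first.
  have [/existsP[i out_i]|] := boolP [exists i, ~~ (row_floor la i <= b i <= onepos la i)%N].
    by rewrite (bigD1 i) //= {1}/w (negbTE out_i) !mul0r.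
  move/existsPn => in_b; case: not_inc => i j lt_ij.
  have := in_b i; have := in_b j; rewrite !negbK /row_floor.
  have -> : (j == 0%N :> nat) = false by lia.
  have le_i : (i <= @inord k j.-1)%N by rewrite inordK; have := ltn_ord j; lia.
  by have := increasing_gap (@onepos_increasing _ _ la) le_i; lia.
rewrite [RHS]big_mkcond; apply: eq_bigr => rho _.
under eq_bigr => i _ do rewrite /w ffunE /=.
have -> : \det (\matrix_(i, j) H (onepos_ffun rho i) j) =
    skipvar p (jt k (fun i => (onepos rho i)%:Z)).
  rewrite jt_rmorph; congr (\det _); apply/matrixP=> i j; by rewrite !mxE /H ffunE.
by rewrite prod_if_expr horizE; case: ifP; rewrite ?mul0r.
Qed.

End HorizontalBranching.

(** An empty part can be dropped: its row is (1, 0, .., 0). *)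
Lemma jt_cons0 m l (a : 'I_l.+1 -> int) : a ord0 = 0 ->
  jt m a = jt m (fun i => a (lift ord0 i) - 1).
Proof.
move=> a0; rewrite /jt (expand_det_row _ ord0) big_ord_recl big1 => [|j _].
  rewrite addr0 mxE a0 subrr [hsymz m 0]hsym0 mul1r /cofactor expr0 mul1r.
  congr (\det _); apply/matrixP=> i j; rewrite !mxE; congr hsymz.
  by rewrite lift0 intS opprD addrA.
by rewrite mxE a0 hsymz_neg ?mul0r //= lift0; lia.
Qed.

(** The columns are linearly dependent, with the coefficients of [vieta]. *)
Lemma jt_too_long k (a : 'I_k.+1 -> int) : (forall i, 0 < a i) -> jt k a = 0.
Proof.
move=> a_gt0; have [c [c0 _ cE]] := vieta k.
pose C : 'M_k.+1 := \matrix_(i < k.+1, j < k.+1) if j == ord0 then c i else (i == j)%:R.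
have detC : \det C = 1.
  rewrite det_trig; last first.
    apply/is_trig_mxP => i j lt_ij; have j0 := leq_ltn_trans (leq0n i) lt_ij.
    by rewrite mxE -!val_eqE /= (gtn_eqF j0) (ltn_eqF lt_ij).
  by rewrite big1 // => i _; rewrite mxE eqxx; case: eqP => // ->.
rewrite /jt -[LHS]mulr1 -detC -det_mulmx (expand_det_col _ ord0) big1 // => i _.
rewrite mxE; under eq_bigr => j _ do rewrite !mxE eqxx mulrC.
by rewrite cE gt_eqF ?mul0r.
Qed.

(** * Changing one letter of the word *)

Lemma nth_filter_pos s i : sorted geq s ->
  nth 0%N [seq p <- s | (0 < p)%N] i = nth 0%N s i.
Proof.
have geq_trans : transitive geq by move=> a b c /= ab bc; apply: leq_trans bc ab.
elim: s i => [|x s IHs] i //= path_s.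
case: posnP => [x0|x_gt0]; last by case: i => [|i] //=; apply/IHs/(path_sorted path_s).
have s0 : all (pred1 0%N) s.
  by apply: sub_all (order_path_min geq_trans path_s) => y; rewrite /= x0 leqn0.
have nth0 j : nth 0%N s j = 0%N.
  case: (ltnP j (size s)) => [lt_j|?]; last by rewrite nth_default.
  by apply/eqP/(allP s0)/mem_nth.
rewrite IHs ?(path_sorted path_s) // nth0.
by case: i => [|i] /=; rewrite ?x0 ?nth0.
Qed.

Lemma nth_nonzero_parts k n (la : boxpart k n) i : nth 0%N (nonzero_parts la) i = part la i.
Proof. by rewrite /nonzero_parts nth_filter_pos //; apply: (valP la). Qed.

Lemma eq_nonzero_parts k n k' n' (la : boxpart k n) (la' : boxpart k' n') :
  (forall i, part la i = part la' i) -> nonzero_parts la = nonzero_parts la'.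
Proof.
have le_size m l m' l' (mu : boxpart m l) (mu' : boxpart m' l') :
    (forall i, part mu i = part mu' i) ->
    (size (nonzero_parts mu) <= size (nonzero_parts mu'))%N.
  move=> eq_mu; rewrite leqNgt; apply/negP => lt_s.
  have := mem_nth 0%N lt_s; rewrite nth_nonzero_parts eq_mu -nth_nonzero_parts.
  by rewrite nth_default // mem_filter.
move=> eq_la; apply: (@eq_from_nth _ 0%N) => [|i _]; last by rewrite !nth_nonzero_parts.
by apply/eqP; rewrite eqn_leq !le_size // => i; rewrite eq_la.
Qed.

Lemma refitP k n k' n' (rho : boxpart k n) (rho' : boxpart k' n') :
  refit k' n' rho = Some rho' <-> (forall i, part rho' i = part rho i).
Proof.
rewrite /refit; case: pickP => [rho1 /eqP eq1|none]; split=> //.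
- case=> <- i; by rewrite -!nth_nonzero_parts eq1.
- move=> eq_rho; congr Some; apply: boxpart_eq => i.
  by rewrite -nth_nonzero_parts eq1 nth_nonzero_parts eq_rho.
- by move/eq_nonzero_parts => /eqP; rewrite none.
Qed.

Lemma refit_up k n (rho : boxpart k n) (rho' : boxpart k.+1 n.-1) :
    refit k.+1 n.-1 rho = Some rho' ->
  schur rho' = jt k.+1 (fun i => (onepos rho i)%:Z).
Proof.
move/refitP => eq_rho; rewrite schur_jt jt_cons0.
  congr (\det _); apply/matrixP=> i j; rewrite !mxE; congr (hsymz _ (_ - _)).
  by rewrite /onepos eq_rho lift0 subSS addnS intS [1 + _]addrC addrK.
by rewrite /onepos eq_rho subSS subn0 addn0 part_out.
Qed.

Lemma refit_exists k n k' n' (rho : boxpart k n) :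
    (forall i, k' <= i -> part rho i = 0)%N -> (part rho 0 <= n')%N ->
  exists rho', refit k' n' rho = Some rho'.
Proof.
move=> out_rho le_n'.
have [i j /andP[ij _]|i _|rho' rho'E] := @boxpart_exists k' n' (part rho).
- exact: part_anti.
- exact: leq_trans (part_anti rho (leq0n i)) le_n'.
exists rho'; apply/refitP => i; case: (ltnP i k') => [/rho'E //|le_i].
by rewrite part_out // out_rho.
Qed.

(** Then the first row of rho has length n, so that its largest position is
    N - 1; it becomes N when an empty part is added. *)
Lemma refit_up_none k n (rho : boxpart k n) : refit k.+1 n.-1 rho = None ->
  (0 < n)%N -> exists i : 'I_k, (onepos rho i).+1 = (n + k)%N.
Proof.
move=> none n_gt0; have [le_n|lt_n] := leqP (part rho 0) n.-1.
  have [|rho'] := @refit_exists _ _ k.+1 n.-1 rho _ le_n; last by rewrite none.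
  by move=> i /ltnW le_ki; apply: part_out.
have le_n := part_le rho 0.
have k_gt0 : (0 < k)%N by rewrite lt0n; apply: contraTneq lt_n => k0; rewrite part_out ?k0.
exists (rev_ord (Ordinal k_gt0)); rewrite -part_onepos /=; lia.
Qed.

Lemma refit_down k n (rho : boxpart k.+1 n) (rho' : boxpart k n.+1) :
  refit k n.+1 rho = Some rho' -> schur rho' = jt k (fun i => (onepos rho i)%:Z).
Proof.
move/refitP => eq_rho; rewrite jt_cons0; last first.
  by rewrite /onepos addn0 subSS subn0 -eq_rho part_out.
rewrite schur_jt; congr (\det _); apply/matrixP=> i j; rewrite !mxE.
congr (hsymz _ (_ - _)).
by rewrite /onepos eq_rho lift0 subSS addnS intS [1 + _]addrC addrK.
Qed.

Lemma refit_down_none k n (rho : boxpart k.+1 n) :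
  refit k n.+1 rho = None -> jt k (fun i => (onepos rho i)%:Z) = 0.
Proof.
move=> none; apply: jt_too_long => i; rewrite ltz_nat lt0n; apply/eqP => exi0.
have [||rho'] := @refit_exists _ _ k n.+1 rho; last by rewrite none.
  move=> l; rewrite leq_eqVlt => /predU1P[<-|]; last exact: part_out.
  have := @increasing_gap _ _ ord0 i (@onepos_increasing _ _ rho) (leq0n i).
  by rewrite exi0 /onepos subSS subn0 /=; lia.
by apply: leqW; apply: part_le.
Qed.

Lemma count_below k (e : 'I_k -> nat) b j : increasing e ->
  (e j < b)%N = (j < \sum_(i < k) (e i < b))%N.
Proof.
move=> inc; case: ltnP => [lt_jb|le_bj]; apply/esym.
  apply: (@leq_trans (\sum_(i < k) (0 <= i < j.+1))%N).
    by rewrite sum_between subn0 leq_min leqnn ltn_ord.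
  apply: leq_sum => i _; case: ltnP => //= le_ij; rewrite lt0b.
  by apply: leq_ltn_trans lt_jb; have := increasing_gap inc le_ij; lia.
apply/negbTE; rewrite -leqNgt; apply: (@leq_trans (\sum_(i < k) (0 <= i < j))%N).
  apply: leq_sum => i _; case: (ltnP i j) => /= [_|le_ji]; first by case: ltnP.
  rewrite leqn0 eqb0 -leqNgt; apply: (leq_trans le_bj).
  by have := increasing_gap inc le_ji; lia.
by rewrite sum_between subn0 geq_minl.
Qed.

Lemma sum_below k (e : 'I_k -> nat) i : increasing e -> (\sum_(j < k) (e j < e i))%N = i.
Proof.
move=> inc; under eq_bigr => j _ do
  rewrite (increasing_mono j i inc) -[(j < i)%N]/(0 <= j < i)%N.
by rewrite sum_between subn0; apply/minn_idPl/ltnW.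
Qed.

(** Counting the positions below b gives the place where b has to be inserted. *)
Lemma insert_increasing k (e : 'I_k -> nat) b (i : 'I_k.+1) :
    increasing e -> (forall j, e j != b) -> nat_of_ord i = (\sum_(j < k) (e j < b))%N ->
  increasing (insert i b e).
Proof.
move=> inc ne_b iE j1 j2; have below j : (e j < b)%N = (j < i)%N.
  by rewrite (count_below _ _ inc) iE.
case: (unliftP i j1) => [l1|] ->; case: (unliftP i j2) => [l2|] ->;
  rewrite ?insert_at ?insert_lift ?ltnn //.
- by rewrite /= ltnNge leq_bump2 -ltnNge => /inc.
- by move=> lt_i; rewrite below; move: lt_i; rewrite /= /bump; case: leqP => //=; lia.
- move=> lt_i; have := below l2; have := ne_b l2; move: lt_i; rewrite /= /bump.
  by case: leqP => //=; lia.
Qed.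

Lemma word_inj k n (la la' : boxpart k n) : word la = word la' -> la = la'.
Proof.
move=> eqw; apply/onepos_inj/increasing_eq; try exact: onepos_increasing.
move=> i; have : [exists j, onepos la i == onepos la' j].
  by rewrite -nth_word -eqw nth_word; apply/existsP; exists i.
by case/existsP=> j /eqP ij; exists j.
Qed.

Lemma size_word k n (la : boxpart k n) : size (word la) = (n + k)%N.
Proof. by rewrite size_mkseq. Qed.

Lemma letter_index_lt N j : (0 < N)%N -> (letter_index N j < N)%N.
Proof.
move=> N_gt0; rewrite /letter_index; have := ltz_pmod (j - 1) (d := N) N_gt0.
by have := modz_ge0 (j - 1) (d := N); lia.
Qed.

Section LetterChange.
Variables (k n : nat).

Lemma letterE (la : boxpart k n) j :
  letter la j = [exists i, letter_index (n + k) j == onepos la i].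
Proof. by rewrite /letter nth_word. Qed.

Lemma word_insert n' (la : boxpart k n) (la' : boxpart k.+1 n') b i :
    (n' + k.+1 = n + k)%N -> (b < n + k)%N ->
    onepos la' i = b -> (forall j, onepos la' (lift i j) = onepos la j) ->
  word la' = set_nth false (word la) b true /\ 
  ((forall j, onepos la j != b) -> word la = set_nth false (word la') b false).
Proof.
move=> eqN lt_b exi exl.
have szm m : (m = n + k)%N -> maxn b.+1 m = m by lia.
have memE p : [exists j, p == onepos la' j] = (p == b) || [exists j, p == onepos la j].
  apply/existsP/orP => [[j /eqP ->]|].
    case: (unliftP i j) => [l|] ->; last by left; rewrite exi.
    by right; apply/existsP; exists l; rewrite exl.
  case=> [/eqP ->|/existsP[l /eqP ->]]; first by exists i; rewrite exi.
  by exists (lift i l); rewrite exl.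
split=> [|ne_b]; apply: (@eq_from_nth _ false); rewrite ?size_set_nth ?size_word ?szm //.
- by move=> p lt_p; rewrite nth_set_nth /= !nth_word memE; case: eqP.
- move=> p lt_p; rewrite nth_set_nth /= !nth_word memE; case: eqP => // ->.
  by apply/existsP => -[j]; rewrite eq_sym (negbTE (ne_b j)).
Qed.

End LetterChange.

Lemma psistar_spec k n (la : boxpart k n) j : (0 < n + k)%N -> letter la j = false ->
  (0 < n)%N /\ exists2 la', psistar j la = Some la' & exists i : 'I_k.+1,
  let b := letter_index (n + k) j in
  [/\ nat_of_ord i = \sum_(l < k) (onepos la l < b), onepos la' i = b &
     forall l, onepos la' (lift i l) = onepos la l]%N.
Proof.
move=> N_gt0 letF; have lt_bN := letter_index_lt j N_gt0; set b := letter_index _ _ in lt_bN *.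
have ne_b l : onepos la l != b.
  by apply: contraFN letF => /eqP lb; rewrite letterE -/b; apply/existsP; exists l; rewrite lb.
have le_k : (\sum_(l < k) (onepos la l < b) <= k)%N.
  by rewrite -[X in (_ <= X)%N]card_ord -sum1_card; apply: leq_sum => l _; case: ltnP.
have lt_k : (\sum_(l < k) (onepos la l < b) < k.+1)%N by [].
pose i := Ordinal lt_k.
have inc : increasing (insert i b (onepos la)).
  by apply: insert_increasing => //; apply: onepos_increasing.
have lt_e l : (insert i b (onepos la) l < n + k)%N.
  case: (unliftP i l) => [l'|] ->; rewrite ?insert_at ?insert_lift //; exact: onepos_lt.
have n_gt0 : (0 < n)%N.
  have := @increasing_gap _ _ ord0 ord_max inc (leq0n k).
  by have := lt_e ord_max; rewrite /=; lia.
split=> //; have eqN : (n.-1 + k.+1 = n + k)%N by lia.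
have [|la' la'E] := @onepos_exists k.+1 n.-1 _ inc; first by move=> l; rewrite eqN.
have ex_i : onepos la' i = b by rewrite la'E insert_at.
have ex_l l : onepos la' (lift i l) = onepos la l by rewrite la'E insert_lift.
have [word_la' _] := word_insert eqN lt_bN ex_i ex_l.
exists la'; last by exists i; rewrite ex_i.
rewrite /psistar letF; case: pickP => [la1 /eqP w1|/(_ la')]; last by rewrite word_la' eqxx.
by congr Some; apply: word_inj; rewrite w1 word_la'.
Qed.

Lemma psi_spec k n (la : boxpart k.+1 n) j : letter la j ->
  exists2 la' : boxpart k n.+1, psi j la = Some la' & exists i : 'I_k.+1,
  let b := letter_index (n + k.+1) j in
  [/\ nat_of_ord i = \sum_(l < k.+1) (onepos la l < b), onepos la i = b &
     forall l, onepos la (lift i l) = onepos la' l]%N.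
Proof.
move=> letT; have := letT; rewrite letterE => /existsP[i /eqP ib].
have inc := @onepos_increasing _ _ la.
have eqN : (n + k.+1 = n.+1 + k)%N by rewrite addnS.
have [|la' la'E] := @onepos_exists k n.+1 _ (increasing_lift i inc).
  by move=> l; rewrite -eqN onepos_lt.
have lt_bN : (letter_index (n + k.+1) j < n.+1 + k)%N by rewrite ib -eqN onepos_lt.
have ex_l l : onepos la (lift i l) = onepos la' l by rewrite la'E.
have [_ word_la'] := word_insert eqN lt_bN (esym ib) ex_l.
exists la'; last by exists i; split; rewrite ?ib ?sum_below.
have {}word_la' : word la' = set_nth false (word la) (letter_index (n + k.+1) j) false.
  apply: word_la' => l; rewrite -ex_l ib; apply/eqP => /(increasing_inj inc)/eqP.
  by rewrite eq_sym (negbTE (neq_lift _ _)).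
rewrite /psi letT; case: pickP => [la1 /eqP w1|/(_ la')]; last by rewrite word_la' eqxx.
by congr Some; apply: word_inj; rewrite w1 word_la'.
Qed.

Lemma psi_none k n (la : boxpart k n) j : psi j la = None -> letter la j = false.
Proof.
case: k la => [|k] la.
  by move=> _; rewrite letterE; apply/existsP => -[[]].
by move=> none; apply: contraTF isT => /psi_spec[la']; rewrite none.
Qed.

Lemma psi_some k n (la : boxpart k n) j : psi j la <> None -> letter la j.
Proof. by rewrite /psi; case: ifP. Qed.

(** * Positions modulo the length of the word *)

(** Positions of letters are periodic of period N. *)
Lemma letter_index_shift N (b : nat) (t : int) : (b < N)%N ->
  letter_index N (b%:Z + 1 + t * N%:Z) = b.
Proof.
move=> lt_bN; rewrite /letter_index.
have -> : b%:Z + 1 + t * N%:Z - 1 = t * N%:Z + b%:Z by lia.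
by rewrite modzMDl modz_small //= lt_bN.
Qed.

Lemma nones_shift k n (la : boxpart k n) (b : nat) (t : int) : (b < n + k)%N ->
  nones la (b%:Z + t * (n + k)%N%:Z) = (\sum_(l < k) (onepos la l < b))%N%:Z + k%:Z * t.
Proof.
move=> lt_bN; rewrite /nones [b%:Z + _]addrC modzMDl modz_small ?lt_bN //= divzMDl; last by lia.
by rewrite divz_small ?addr0 ?lt_bN // count_word // ltnW.
Qed.

Lemma exprz_sign (z t : int) (m : nat) : z = m%:Z + t * 2 -> (-1 : int) ^ z = (-1) ^+ m.
Proof.
move=> ->; rewrite exprzDr ?unitrN1 // [t * 2]mulrC -exprz_exp.
by rewrite (_ : (-1) ^ 2 = 1) // exp1rz mulr1.
Qed.

(** * Changing the sign of q *)

Definition signflip (p : {poly int}) : {poly int} := comp_poly (- 'X) p.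
HB.instance Definition _ := GRing.RMorphism.copy signflip (comp_poly (- 'X)).

Lemma coef_signflip p d : (signflip p)`_d = (-1) ^+ d * p`_d.
Proof.
rewrite /signflip /= comp_polyE coef_sum.
under eq_bigr => i _ do
  rewrite exprNn coefZ -(rmorph_sign polyC) coefCM coefXn.
case: (ltnP d (size p)) => [lt_d|le_d].
  rewrite (bigD1 (Ordinal lt_d)) //= eqxx mulr1 mulrC big1 ?addr0 // => i.
  by rewrite -val_eqE /= eq_sym => /negbTE ->; rewrite !mulr0.
rewrite big1 => [|i _]; first by rewrite nth_default ?mulr0.
by rewrite gtn_eqF ?mulr0 // (leq_trans (ltn_ord i)).
Qed.

(** Base change. *)
Lemma wcoord_rmorph (S T : comNzRingType) (f : {rmorphism S -> T}) N c k
    (e : 'I_k -> nat) (p : {mpoly S[k]}) :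
  f (wcoord N c e p) = wcoord N (f c) e (map_mpoly f p).
Proof.
rewrite [in RHS](mpolyE p) (rmorph_sum (map_mpoly f)) linear_sum.
rewrite [wcoord N c e p]/linext rmorph_sum.
apply: eq_bigr => m _ /=; rewrite rmorphM map_mpolyZ map_mpolyX linearZ /= /wcoord linextX.
congr (_ * _); rewrite /wcoordm -det_map_mx; congr (\det _).
by apply/matrixP=> i j; rewrite !mxE /coord rmorphM rmorph_nat rmorphXn.
Qed.

Lemma map_mpoly_schur (f : {rmorphism R -> R}) k n (la : boxpart k n) :
  map_mpoly f (schur la) = schur la.
Proof.
rewrite schur_jt jt_rmorph; congr (\det _); apply/matrixP=> i j; rewrite !mxE.
case: (_ - _) => r; last by rewrite rmorph0.
apply/mpolyP=> m; rewrite mcoeff_map_mpoly !mcoeff_hsym.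
exact: rmorph_nat.
Qed.

(** With the opposite sign of q, as needed when the number of ones changes by one,
    only the signs of the odd degrees change because Schur polynomials do not
    involve q. *)
Lemma GW_wcoord k n (la mu nu : boxpart k n) d : (0 < n + k)%N ->
  (wcoord (n + k) (- signed_q k) (onepos nu) (schur la * 'X_[expo (onepos mu)]))`_d =
  (-1) ^+ d * GW la mu nu d.
Proof.
move=> N_gt0; have cN : signflip (signed_q k) = - signed_q k.
  by rewrite /signed_q rmorphM rmorphXn rmorphN1 /= /signflip comp_polyX mulrN.
rewrite -cN -[schur la](map_mpoly_schur signflip).
have XE : map_mpoly signflip 'X_[expo (onepos mu)] = 'X_[expo (onepos mu)] by rewrite map_mpolyX.
rewrite -{1}XE -rmorphM -wcoord_rmorph coef_signflip.
by rewrite /GW qexpansionE.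
Qed.

(** * Moving one letter through a Schur polynomial *)

Lemma expo_splitE k (e : 'I_k.+1 -> nat) p :
  'X_[expo e] = 'X_p ^+ e p * skipvar p 'X_[expo (e \o lift p)] :> {mpoly R[k.+1]}.
Proof.
rewrite skipvarXM; congr 'X_[_]; apply: (mnm_lift_eqP (p := p)) => [|i].
  by rewrite mnmE insert_mnm_at.
by rewrite insert_mnm_lift !mnmE.
Qed.

(** Contracting the wedge with exponents e' against the coordinate of x^(e' i)
    leaves the term in which the factor number i is removed. Under the sum, the
    polynomial acts on all factors but the contracted one. *)
Lemma wcoord_delete N (c : R) k (e : 'I_k -> nat) (e' : 'I_k.+1 -> nat)
    (i : 'I_k.+1) (f : {mpoly R[k]}) :
    injective e' -> (forall l, e' l < N)%N ->
  (-1) ^+ i * wcoord N c e (f * 'X_[expo (e' \o lift i)]) =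
  \sum_(p < k.+1) (-1) ^+ p * mixed N c p (e' i) e (skipvar p f * 'X_[expo e']).
Proof.
move=> inj_e' lt_e'N.
have mixE p : mixed N c p (e' i) e (skipvar p f * 'X_[expo e']) =
    (p == i)%:R * wcoord N c e (f * 'X_[expo (e' \o lift p)]).
  by rewrite (expo_splitE _ p) mulrCA -rmorphM mixed_skipvar coord_small // (inj_eq inj_e').
rewrite (bigD1 i) //= mixE eqxx mul1r big1 ?addr0 // => p neq_pi.
by rewrite mixE (negbTE neq_pi) mul0r mulr0.
Qed.

Lemma coord_ind N (c : R) (f g : nat -> R) : (0 < N)%N ->
    (forall a, f (a + N)%N = c * f a) -> (forall a, g (a + N)%N = c * g a) ->
    (forall a, (a < N)%N -> f a = g a) -> f =1 g.
Proof.
move=> N_gt0 fN gN fg; elim/ltn_ind=> a IHa; case: (ltnP a N) => [/fg //|le_Na].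
by rewrite -(subnK le_Na) fN gN IHa //; lia.
Qed.

(** Multiplication by x^r, transposed. *)
Lemma coord_shift N (c : R) b r a : (r <= b < N)%N ->
  coord N c b (a + r) = 1 * coord N c (b - r) a.
Proof.
move=> /andP[le_rb lt_bN]; have N_gt0 := leq_ltn_trans (leq0n b) lt_bN; rewrite mul1r.
move: a; apply: (@coord_ind N c) => // a => [||lt_aN].
- by rewrite addnAC coordDN.
- by rewrite coordDN.
rewrite [RHS]coord_small //; case: (ltnP (a + r) N) => [lt_N|le_N].
  by rewrite coord_small // -[in LHS](subnK le_rb) eqn_add2r.
rewrite -(subnK le_N) coordDN // coord_small; last by lia.
have -> : (a + r - N == b)%N = false by lia.
have -> : (a == b - r)%N = false by lia.
by rewrite mulr0.
Qed.

Lemma coord_wrap N (c : R) b r a : (b < r <= N)%N ->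
  coord N c b (a + r) = c * coord N c (N + b - r) a.
Proof.
move=> /andP[lt_br le_rN]; have N_gt0 : (0 < N)%N by lia.
move: a; apply: (@coord_ind N c) => // a => [||lt_aN].
- by rewrite addnAC coordDN.
- by rewrite coordDN.
rewrite [coord _ _ (N + b - r) _]coord_small //; case: (ltnP (a + r) N) => [lt_N|le_N].
  have -> : (a == N + b - r)%N = false by lia.
  by rewrite coord_small // (_ : (a + r == b)%N = false) ?mulr0 //; lia.
rewrite -{1}(subnK le_N) coordDN // coord_small; last by lia.
by congr (_ * (nat_of_bool _)%:R); lia.
Qed.

Lemma coef_sign m (p : R) d : ((-1) ^+ m * p)`_d = (-1) ^+ m * p`_d.
Proof.
by rewrite -signr_odd -[in RHS]signr_odd; case: odd; rewrite ?mul1r // !mulN1r coefN.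
Qed.

Lemma coef_signed_q k (p : R) d :
  (signed_q k * p)`_d = (-1) ^+ k.+1 * (if d is d'.+1 then p`_d' else 0).
Proof. by rewrite /signed_q -mulrA coef_sign coefXM; case: d. Qed.

Lemma signed_qS k : signed_q k.+1 = - signed_q k.
Proof. by rewrite /signed_q exprS mulN1r mulNr. Qed.

Lemma signed_qN k : signed_q k = - signed_q k.+1.
Proof. by rewrite signed_qS opprK. Qed.

Lemma GW0_none k n (la mu : option (boxpart k n)) d : GW0 la mu None d = 0.
Proof. by case: la => // la; case: mu. Qed.

(** As a partition with k + 1 rows, rho has a zero part and a first part equal to
    n, that is, positions 0 and N, which agree modulo N. *)
Lemma wcoord_refit_none k n (rho : boxpart k n) (mu : boxpart k.+1 n.-1) (c : R) e :
    (0 < n)%N -> refit k.+1 n.-1 rho = None ->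
  wcoord (n + k) c e (jt k.+1 (fun i => (onepos rho i)%:Z) * 'X_[expo (onepos mu)]) = 0.
Proof.
move=> n_gt0 /refit_up_none/(_ n_gt0)[i exi].
have N_gt0 : (0 < n + k)%N by lia.
(* the positions of rho with an empty part added *)
pose b (l : 'I_k.+1) : nat := oapp (fun l => (onepos rho l).+1) 0%N (unlift ord0 l).
have jtE : jt k.+1 (fun i => (onepos rho i)%:Z) = jt k.+1 (fun l => (b l)%:Z).
  rewrite [RHS]jt_cons0; last by rewrite /b unlift_none.
  congr (\det _); apply/matrixP=> r s; rewrite /b.
  by rewrite !mxE liftK /= intS [1 + _]addrC addrK.
rewrite jtE -wcoord_schur ?jt_sym // [_ * schur mu]mulrC wcoord_jt ?schur_sym //.
(* the position N replaced by N - N = 0, which already occurs *)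
pose b' (l : 'I_k.+1) : nat := if l == lift ord0 i then 0%N else b l.
have -> : expo b = (expo b' + U_(lift ord0 i) *+ (n + k))%MM.
  apply/mnmP=> l; rewrite mnmDE mulmnE mnm1E !mnmE /b' eq_sym.
  by case: eqP => [<-|_]; rewrite /b ?mul0n ?addn0 ?mul1n // liftK /= exi.
rewrite mpolyXD -mpolyXn mulrA wcoord_quasi //.
rewrite (@wcoord_eq0 _ _ _ _ _ ord0 (lift ord0 i)) ?mulr0 ?schur_sym ?neq_lift //.
by rewrite /b' eqxx; case: eqP => //; rewrite /b unlift_none.
Qed.

Lemma vert_size_rows k n (la rho : boxpart k n) : vertical_strip la rho -> (skew_size la rho <= k)%N.
Proof.
move=> /forallP ver; rewrite -[X in (_ <= X)%N]card_ord -sum1_card.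
by apply: leq_sum => i _; have := ver i; lia.
Qed.

(** Contract the wedge of mu' = psi_j^* mu against the coordinate of x^(j-1), let
    s_la act, and move it across the contraction with the vertical branching
    rule. *)
Lemma GW_vertical k n (la mu nu : boxpart k n) (d j : nat) :
    (1 <= j <= n + k)%N -> letter mu j%:Z = false ->
  GW la mu nu d =
  \sum_(0 <= r < (plength la).+1)
    (-1) ^ (d%:Z + r%:Z + nones mu (j%:Z - 1) + nones nu (j%:Z - r%:Z - 1)) *
    \sum_(rho : boxpart k n | vstrip la rho r)
      GW0 (refit k.+1 n.-1 rho) (psistar j%:Z mu) (psistar (j%:Z - r%:Z) nu)
          (vdegree d j r).
Proof.
move=> /andP[j_gt0 le_jN] letF; have N_gt0 : (0 < n + k)%N by lia.
set N := (n + k)%N in le_jN N_gt0 *.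
have [n_gt0 [mu' psi_mu]] := psistar_spec N_gt0 letF.
pose b := j.-1; have lt_bN : (b < N)%N by rewrite /b; lia.
have -> : letter_index (n + k) j = b.
  by rewrite -(letter_index_shift 0 lt_bN); congr letter_index; rewrite /b; lia.
case=> i [iE exi exl].
have eqN : (n.-1 + k.+1 = N)%N by rewrite /N; lia.
pose c := signed_q k; pose E := onepos mu'.
have incE : increasing E := @onepos_increasing _ _ mu'.
have lt_EN l : (E l < N)%N by rewrite -eqN onepos_lt.
pose J (rho : boxpart k n) := jt k.+1 (fun i => (onepos rho i)%:Z).
(* does the position j - r lie before the start of the word? *)
pose wrap r := (b < r)%N.
pose x r := if wrap r then c else 1.
pose br r := (if wrap r then N + b - r else b - r)%N.
have GWE : (-1) ^+ i * wcoord N c (onepos nu) (schur la * 'X_[expo (onepos mu)]) =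
    \sum_(rho | vertical_strip la rho) (-1) ^+ skew_size la rho * (x (skew_size la rho) *
      contraction N c (br (skew_size la rho)) (onepos nu) (J rho * 'X_[expo E])).
  have -> : expo (onepos mu) = expo (E \o lift i) by apply: eq_expo => l; rewrite /= /E exl.
  rewrite (wcoord_delete _ _ _ _ (increasing_inj incE) lt_EN) [E i]exi.
  under eq_bigr => p _.
    rewrite schur_vertical_branching mulr_suml linear_sum mulr_sumr /=.
    over.
  rewrite exchange_big; apply: eq_bigr => rho ver /=.
  have le_rN : (skew_size la rho <= N)%N.
    by apply: leq_trans (vert_size_rows ver) _; apply: leq_addl.
  set r := skew_size la rho in le_rN *; rewrite /contraction !mulr_sumr.
  apply: eq_bigr => p _.
  rewrite -[_ * _ * 'X_[_]]mulrA (@mixed_signX _ _ _ _ _ _ (br r) _ _ _ (x r)).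
    by rewrite mulrCA; congr (_ * _); rewrite mulrCA.
  move=> a; rewrite /x /br /wrap; case: ltnP => [lt_br|le_rb].
    by rewrite coord_wrap // lt_br.
  by rewrite coord_shift // le_rb.
under eq_bigr => r _ do rewrite mulr_sumr.
(* the strip determines r *)
rewrite (sum_by_size _ (vstripE la) (@vert_size _ _ la)).
have -> : GW la mu nu d = (-1) ^+ i * ((-1) ^+ i * wcoord N c (onepos nu)
    (schur la * 'X_[expo (onepos mu)]))`_d.
  by rewrite coef_sign signrMK /GW qexpansionE.
rewrite GWE coef_sum mulr_sumr; apply: eq_bigr => rho ver.
have le_rk := vert_size_rows ver; set r := skew_size la rho in le_rk *.
have le_rN : (r <= N)%N by apply: leq_trans le_rk _; apply: leq_addl.
have nones_mu : nones mu (j%:Z - 1) = i%:Z.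
  have -> : j%:Z - 1 = b%:Z + 0 * (n + k)%N%:Z by rewrite /b; lia.
  by rewrite nones_shift // iE mulr0 addr0.
pose t : int := if wrap r then -1 else 0.
have lt_brN : (br r < N)%N by rewrite /br /wrap; case: ifP; lia.
have pos_nu : j%:Z - r%:Z = (br r)%:Z + 1 + t * N%:Z.
  by rewrite /br /t /wrap; case: ifP; rewrite /b; lia.
have li_nu : letter_index (n + k) (j%:Z - r%:Z) = br r.
  by rewrite pos_nu letter_index_shift.
have -> : j%:Z - r%:Z - 1 = (br r)%:Z + t * N%:Z by rewrite pos_nu; lia.
rewrite nones_shift // nones_mu psi_mu.
have [letT|letF'] := boolP (letter nu (j%:Z - r%:Z)).
  rewrite /psistar letT GW0_none mulr0 contraction_mem ?mulr0 ?coef0 ?mulr0 //.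
  by move: letT; rewrite letterE li_nu => /existsP[l /eqP ->]; exists l.
have [_ [nu' psi_nu]] := psistar_spec N_gt0 (negbTE letF').
rewrite li_nu => -[l [lE exl_nu ex_lift]]; rewrite psi_nu -lE.
have colE f : wcoord N c (onepos nu') f = (-1) ^+ l * contraction N c (br r) (onepos nu) f.
  by rewrite (wcoord_col _ _ _ l) exl_nu (eq_contraction _ _ _ _ ex_lift).
have -> : contraction N c (br r) (onepos nu) (J rho * 'X_[expo E]) =
    (-1) ^+ l * wcoord N c (onepos nu') (J rho * 'X_[expo E]).
  by rewrite colE signrMK.
case refitE : (refit k.+1 n.-1 rho) => [rho'|]; last first.
  by rewrite /= mulr0 /J wcoord_refit_none // !mulr0 coef0 mulr0.
have -> : vdegree d j r = if wrap r then d%:Z - 1 else d%:Z.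
  by rewrite /vdegree (_ : (j <= r)%N = wrap r) // /wrap /b; lia.
have N'_gt0 : (0 < n.-1 + k.+1)%N by rewrite eqN.
have GWd d' : (wcoord N c (onepos nu') (J rho * 'X_[expo E]))`_d' =
    (-1) ^+ d' * GW rho' mu' nu' d'.
  by rewrite /J -(refit_up refitE) -GW_wcoord // -signed_qN eqN.
rewrite !coef_sign /x /t; case: (wrap r).
  rewrite coef_signed_q (@exprz_sign _ (- k%:Z) (d + r + i + l + k)); last by lia.
  case: d => [|d]; first by rewrite !mulr0.
  rewrite (_ : d.+1%:Z - 1 = d%:Z); last by lia.
  rewrite coef_sign GWd !mulrA -!exprD /=; congr ((-1) ^+ _ * _); lia.
rewrite mul1r coef_sign GWd (@exprz_sign _ 0 (d + r + i + l)); last by lia.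
by rewrite !mulrA -!exprD; congr ((-1) ^+ _ * _); lia.
Qed.

Lemma sign3E (a b c : nat) (x : int) :
  (-1) ^+ a * ((-1) ^+ b * ((-1) ^+ c * x)) = (-1) ^+ (a + b + c) * x.
Proof. by rewrite !mulrA -!exprD. Qed.

(** Pull the factor x^(j-1) out of the wedge of mu and apply the horizontal
    branching rule to that factor. *)
Lemma GW_horizontal k n (la mu nu : boxpart k.+1 n) (d j : nat) :
    (1 <= j <= n + k.+1)%N -> letter mu j%:Z ->
  GW la mu nu d =
  \sum_(0 <= r < (part la 0).+1)
    (-1) ^ (d%:Z + nones mu (j%:Z - 1) + nones nu (j%:Z + r%:Z - 1)) *
    \sum_(rho : boxpart k.+1 n | hstrip la rho r)
      GW0 (refit k n.+1 rho) (psi j%:Z mu) (psi (j%:Z + r%:Z) nu)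
          (hdegree (n + k.+1) d j r).
Proof.
move=> /andP[j_gt0 le_jN] letT; have N_gt0 : (0 < n + k.+1)%N by lia.
set N := (n + k.+1)%N in le_jN N_gt0 *.
have [mu' psi_mu] := psi_spec letT.
pose b := j.-1; have lt_bN : (b < N)%N by rewrite /b; lia.
have -> : letter_index (n + k.+1) j = b.
  by rewrite -(letter_index_shift 0 lt_bN); congr letter_index; rewrite /b; lia.
case=> i [iE exi exl].
have eqN : (n.+1 + k = N)%N by rewrite /N; lia.
pose c := signed_q k.+1.
pose J rho := jt k (fun i : 'I_k.+1 => (onepos (rho : boxpart k.+1 n) i)%:Z).
(* does the position j + r lie beyond the end of the word? *)
pose wrap r := (N <= b + r)%N.
pose br r := (if wrap r then b + r - N else b + r)%N.
have GWE : wcoord N c (onepos nu) (schur la * 'X_[expo (onepos mu)]) =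
    \sum_(rho | horizontal_strip la rho) \sum_(l < k.+1) (-1) ^+ (i + l) *
      coord N c (onepos nu l) (skew_size la rho + b) *
      wcoord N c (onepos nu \o lift l) (J rho * 'X_[expo (onepos mu')]).
  rewrite (schur_horizontal_branching i) mulr_suml linear_sum; apply: eq_bigr => rho _ /=.
  have lift_mu : expo (onepos mu \o lift i) = expo (onepos mu').
    by apply: eq_expo => l; rewrite /= exl.
  by rewrite (expo_splitE _ i) exi lift_mu mulrACA -exprD -rmorphM wcoord_row.
under eq_bigr => r _ do rewrite mulr_sumr.
(* the strip determines r *)
rewrite (sum_by_size _ (hstripE la) (@horiz_size _ _ la)).
rewrite /GW qexpansionE // GWE coef_sum; apply: eq_bigr => rho hor.
have le_rn : (skew_size la rho <= n)%N := leq_trans (horiz_size hor) (part_le la 0).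
set r := skew_size la rho in le_rn *.
have nones_mu : nones mu (j%:Z - 1) = i%:Z.
  have -> : j%:Z - 1 = b%:Z + 0 * (n + k.+1)%N%:Z by rewrite /b; lia.
  by rewrite nones_shift // iE mulr0 addr0.
pose t : int := if wrap r then 1 else 0.
have lt_brN : (br r < N)%N by rewrite /br /wrap; case: ifP; lia.
have pos_nu : j%:Z + r%:Z = (br r)%:Z + 1 + t * N%:Z.
  by rewrite /br /t /wrap; case: ifP; rewrite /b; lia.
have li_nu : letter_index (n + k.+1) (j%:Z + r%:Z) = br r.
  by rewrite pos_nu letter_index_shift.
have -> : j%:Z + r%:Z - 1 = (br r)%:Z + t * N%:Z by rewrite pos_nu; lia.
rewrite nones_shift // nones_mu psi_mu.
pose x := if wrap r then c else 1.
have coordE e : coord N c e (r + b) = x * (br r == e)%:R.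
  rewrite /x /br /wrap addnC; case: leqP => [le_N|lt_N].
    by rewrite -{1}(subnK le_N) coordDN // coord_small //; lia.
  by rewrite mul1r coord_small.
have [letT'|letF] := boolP (letter nu (j%:Z + r%:Z)); last first.
  rewrite /psi (negbTE letF) GW0_none mulr0 big1 ?coef0 // => l _.
  rewrite coordE; case: eqP => [brE|]; last by rewrite !mulr0 mul0r.
  by case/negP: letF; rewrite letterE li_nu; apply/existsP; exists l; rewrite brE.
have [nu' psi_nu] := psi_spec letT'.
rewrite li_nu => -[l [lE exl_nu ex_lift]]; rewrite psi_nu -lE.
rewrite (bigD1 l) //= big1 ?addr0 => [|l' neq_l]; last first.
  rewrite coordE -exl_nu (inj_eq (increasing_inj (@onepos_increasing _ _ nu))).
  by rewrite eq_sym (negbTE neq_l) !mulr0 mul0r.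
rewrite coordE exl_nu eqxx mulr1 (eq_wcoord _ _ _ ex_lift) -mulrA.
case refitE : (refit k n.+1 rho) => [rho'|]; last first.
  by rewrite /= mulr0 /J (refit_down_none refitE) mul0r linear0 !mulr0 coef0.
have -> : hdegree N d j r = if wrap r then d%:Z - 1 else d%:Z.
  by rewrite /hdegree (_ : (N < j + r)%N = wrap r) // /wrap /b; lia.
have N'_gt0 : (0 < n.+1 + k)%N by rewrite eqN.
have GWd d' : (wcoord N c (onepos nu') (J rho * 'X_[expo (onepos mu')]))`_d' =
    (-1) ^+ d' * GW rho' mu' nu' d'.
  by rewrite /J -(refit_down refitE) -GW_wcoord // -signed_qS eqN.
rewrite !coef_sign /x /t; case: (wrap r).
  rewrite coef_signed_q (@exprz_sign _ 0 (d + i + l + k.+1)); last by lia.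
  case: d => [|d]; first by rewrite !mulr0.
  rewrite (_ : d.+1%:Z - 1 = d%:Z); last by lia.
  rewrite GWd sign3E -signr_odd -[in RHS]signr_odd /=.
  by congr ((-1) ^+ nat_of_bool _ * _); lia.
rewrite mul1r GWd (@exprz_sign _ 0 (d + i + l)); last by lia.
by rewrite !mulrA -!exprD; congr ((-1) ^+ _ * _); lia.
Qed.

Theorem corollary11p7 (k n : nat) (la mu nu : boxpart k n) (d j : nat)
    (hj : (1 <= j <= n + k)%N) :
  (psi j%:Z mu = None ->
     GW la mu nu d =
     \sum_(0 <= r < (plength la).+1)
       (-1) ^ (d%:Z + r%:Z + nones mu (j%:Z - 1) + nones nu (j%:Z - r%:Z - 1)) *
       \sum_(rho : boxpart k n | vstrip la rho r)
         GW0 (refit k.+1 n.-1 rho) (psistar j%:Z mu) (psistar (j%:Z - r%:Z) nu)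
             (vdegree d j r)) /\
  (psi j%:Z mu <> None ->
     GW la mu nu d =
     \sum_(0 <= r < (part la 0).+1)
       (-1) ^ (d%:Z + nones mu (j%:Z - 1) + nones nu (j%:Z + r%:Z - 1)) *
       \sum_(rho : boxpart k n | hstrip la rho r)
         GW0 (refit k.-1 n.+1 rho) (psi j%:Z mu) (psi (j%:Z + r%:Z) nu)
             (hdegree (n + k) d j r)).
Proof.
split=> [/psi_none letF | /psi_some letT]; first exact: GW_vertical.
case: k la mu nu hj letT => [|k] la mu nu hj letT; last exact: GW_horizontal.
by move: letT; rewrite letterE => /existsP[[]].
Qed.
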